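(* Let $\mathcal S=(R_1,\dots,R_m)$ be a database schema, $\Gamma$ a finite set of tuple-generating dependencies over $\mathcal S$, and $I$ a finite initial database instance over $\mathcal S$. Then there exist a signature $\Sigma$ (containing each relation symbol of $\mathcal S$ as a function symbol of the same arity, each Skolem function symbol of $\Gamma$, and each domain element occurring in $I$ as a nullary symbol), a term rewriting system $\mathcal R$ over $\Sigma$, and a ground term $t\in T(\Sigma)$ such that $$\xi(\mathrm{EqSat}(\mathcal R,t))=\mathrm{SklCh}(\Gamma,I).$$ Moreover, the Skolem chase of $\Gamma$ on $I$ terminates if and only if equality saturation terminates on $\mathcal R$ and $t$.
   Context: **Skolem chase.** A database instance over $\mathcal S$ is viewed as a set of atoms $R(\vec a)$. A tuple-generating dependency (TGD) is a formula $d:\lambda(\vec x,\vec y)\to\exists\vec z\,\rho(\vec x,\vec z)$ with $\lambda,\rho$ conjunctions of relational atoms over variables. It is Skolemized to $\lambda(\vec x,\vec y)\to\rho(\vec x,f^d_{z_1}(\vec x),\dots,f^d_{z_k}(\vec x))$, where the $f^d_{z_j}$ are distinct uninterpreted function symbols, so that values are ground terms built from Skolem function symbols and the domain elements of $I$. The Skolem chase $\mathrm{SklCh}(\Gamma,I)$ is the least fixpoint, starting from $I$, of the immediate consequence operator that adds to an instance all instantiated heads of Skolemized TGDs whose bodies are matched in the instance; it terminates if the fixpoint is reached after finitely many iterations. **E-graphs.** A signature $\Sigma$ is a finite set of function symbols with arities; $T(\Sigma)$ is the set of ground terms. A term rewriting system $\mathcal R$ is a set of rules $\mathit{lhs}\to\mathit{rhs}$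 between terms with variables, with $\mathrm{Var}(\mathit{rhs})\subseteq\mathrm{Var}(\mathit{lhs})$. A (bottom-up) tree automaton $\mathcal A=\langle Q,\Sigma,\Delta\rangle$ (no final states) has a possibly infinite set $Q$ of states and a possibly infinite set $\Delta$ of transitions $f(q_1,\dots,q_n)\to q$. Viewing states as nullary symbols, $\to^*_{\mathcal A}$ is the reflexive-transitive closure of rewriting by $\Delta$ on $T(\Sigma\cup Q)$. $\mathcal A$ is deterministic if $s\to^*_{\mathcal A}q_1$ and $s\to^*_{\mathcal A}q_2$ ($s\in T(\Sigma)$, $q_i\in Q$) imply $q_1=q_2$, and reachable if every state $q$ satisfies $s\to^*_{\mathcal A}q$ for some $s\in T(\Sigma)$. An E-graph is a deterministic and reachable tree automaton. $\mathcal L(G)$ is the set of $s\in T(\Sigma)$ with $s\to^*_G c$ for some state $c$ of $G$. A homomorphism is a map of states that sends transitions to transitions; $\mathcal A\sqsubseteq\mathcal B$ means a homomorphism $\mathcal A\to\mathcal B$ exists; this is a partial order on E-graphs up to isomorphism, with all least upper bounds $\bigsqcup$. $\mathrm{CC}(\mathcal A)$, for a reachable tree automaton $\mathcal A$, is the $\sqsubseteq$-least E-graph above $\mathcal A$. **Equality saturation.** For an E-graph $G$ with states $Q$, $T_{\mathcal R}(G)$ is the tree automaton obtained from $G$ by adding, for every rule $\mathit{lhs}\to\mathit{rhs}$ in $\mathcal R$, every $\sigma:\mathrm{Var}(\mathit{lhs})\to Q$ and $c\in Q$ with $\mathit{lhs}[\sigma]\to^*_G c$, the flattening of $s=\mathit{rhs}[\sigma]$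 with root $c$: put $q_s=c$, $q_u=u$ for subterms $u\in Q$, a fresh state $q_u$ for every other proper subterm $u$ of $s$, and add the transition $f(q_{u_1},\dots,q_{u_k})\to q_u$ for every subterm $u=f(u_1,\dots,u_k)$ of $s$ with $f\in\Sigma$; if $s$ is itself a state, it is identified with $c$. Let $\mathrm{ICO}_{\mathcal R}=\mathrm{CC}\circ T_{\mathcal R}$ and $\mathrm{EqSat}(\mathcal R,G)=\bigsqcup_{i\ge0}\mathrm{ICO}^{(i)}_{\mathcal R}(G)$. $\mathrm{EqSat}(\mathcal R,t)$ means $\mathrm{EqSat}(\mathcal R,G_t)$, where $G_t$ is the E-graph with one state $q_u$ per subterm $u$ of $t$ and the transitions $f(q_{u_1},\dots,q_{u_k})\to q_u$ for $u=f(u_1,\dots,u_k)$. Equality saturation terminates on $\mathcal R$ and $t$ if $\mathrm{ICO}^{(n)}_{\mathcal R}(G_t)$ is a fixpoint of $\mathrm{ICO}_{\mathcal R}$ (up to isomorphism) for some finite $n$. **The map $\xi$.** $\xi(G)=\{R(c_1,\dots,c_k)\in\mathcal L(G)\mid R\text{ is a relation symbol in }\mathcal S\}$, read as a set of atoms whose arguments are ground terms. *)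

(* Defs.v *)
(* Finite sets (signatures, rewriting systems, sets of TGDs, initial instances)
   are lists read through [List.In]; possibly infinite sets have type [set T]. *)
From Stdlib Require List.
From Stdlib Require Import Relation_Operators.
From mathcomp Require Import all_boot.
From mathcomp Require Import boolp classical_sets.

Set Implicit Arguments.
Unset Strict Implicit.
Unset Printing Implicit Defensive.

Local Open Scope classical_set_scope.

Inductive term (F V : Type) : Type :=
| Var of V
| App of F & seq (term F V).
Arguments Var {F V} _.
Arguments App {F V} _ _.

Notation gterm F := (term F void).

Section Terms.
Variable F : Type.

Lemma term_nested_ind (V : Type) (P : term F V -> Prop) :
  (forall v, P (Var v)) ->
  (forall f ts, (forall t, List.In t ts -> P t) -> P (App f ts)) ->
  forall t, P t.
Proof.
move=> HV HA; fix IH 1; case=> [v|f ts]; first exact: HV.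
apply: HA; elim: ts => [|t ts IHts] u /=; first by case.
by case=> [<-|]; [exact: IH | exact: IHts].
Qed.

Section Subst.
Variables (V W : Type) (s : V -> term F W).

Fixpoint tsubst (t : term F V) : term F W :=
  match t with
  | Var v => s v
  | App f ts => App f (map tsubst ts)
  end.

Fixpoint tvars (t : term F V) : seq V :=
  match t with
  | Var v => [:: v]
  | App _ ts => flatten (map tvars ts)
  end.

End Subst.

Inductive subterm (V : Type) (u : term F V) : term F V -> Prop :=
| subterm_refl : subterm u u
| subterm_arg f ts t : List.In t ts -> subterm u t -> subterm u (App f ts).

Inductive proper_subterm (V : Type) (u : term F V) : term F V -> Prop :=
| proper_subterm_arg f ts t :
    List.In t ts -> subterm u t -> proper_subterm u (App f ts).

Definition is_var (V : Type) (t : term F V) : bool :=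
  if t is Var _ then true else false.

Lemma subterm_arg_proper (V : Type) f (ts : seq (term F V)) t s :
  List.In t ts -> subterm (App f ts) s -> proper_subterm t s.
Proof.
move=> Hin; elim=> [|g us u Hu _ IH].
  by apply: proper_subterm_arg Hin _; apply: subterm_refl.
apply: proper_subterm_arg Hu _; case: IH => h vs v Hv Hs.
exact: subterm_arg _ Hv Hs.
Qed.

End Terms.

Record signature (F : Type) := Signature {
  sig_syms : seq F;
  sig_arity : F -> nat }.

Section Over.
Variables (F V : Type) (Sg : signature F).

Fixpoint term_over (t : term F V) : Prop :=
  match t with
  | Var _ => True
  | App f ts => [/\ List.In f (sig_syms Sg), size ts = sig_arity Sg f &
      foldr (fun u P => term_over u /\ P) True ts]
  end.

End Over.

Definition ground_over (F : Type) (Sg : signature F) : Type :=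
  {t : gterm F | term_over Sg t}.

Record trs (F : Type) (Sg : signature F) := Trs {
  trs_rules : seq (term F nat * term F nat);
  trs_lhs_over : forall r, List.In r trs_rules -> term_over Sg r.1;
  trs_rhs_over : forall r, List.In r trs_rules -> term_over Sg r.2;
  trs_vars : forall r, List.In r trs_rules -> {subset tvars r.2 <= tvars r.1} }.

Section OverFacts.
Variables (F : Type) (Sg : signature F).

Lemma term_over_args (V : Type) f (ts : seq (term F V)) :
  term_over Sg (App f ts) <->
  [/\ List.In f (sig_syms Sg), size ts = sig_arity Sg f &
      forall t, List.In t ts -> term_over Sg t].
Proof.
have E : foldr (fun u P => term_over Sg u /\ P) True ts <->
    forall t, List.In t ts -> term_over Sg t.
  elim: ts => [|t ts IH] //=; split.
    by case=> Ht /IH Hts u [<-|/Hts].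
  by move=> H; split; [apply: H; left | apply/IH => u Hu; apply: H; right].
by rewrite /=; split=> -[? ? /E ?]; split.
Qed.

Lemma In_map_inv (A B : Type) (g : A -> B) (s : seq A) b :
  List.In b (map g s) -> exists2 a, List.In a s & b = g a.
Proof.
elim: s => [|a s IH] //= [<-|/IH[a' ? ->]]; first by exists a; [left|].
by exists a' => //; right.
Qed.

Lemma In_map (A B : Type) (g : A -> B) (s : seq A) a :
  List.In a s -> List.In (g a) (map g s).
Proof. by elim: s => [|a' s IH] //= [->|/IH]; [left|right]. Qed.

Lemma term_over_subst (V W : Type) (s : V -> term F W) (t : term F V) :
  (forall v, term_over Sg (s v)) -> term_over Sg t ->
  term_over Sg (tsubst s t).
Proof.
move=> Hs; elim/term_nested_ind: t => [v _|f ts IH /term_over_args[Hf Hsz Ht]].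
  exact: Hs.
apply/term_over_args; split=> //; first by rewrite size_map.
by move=> u Hu; have [t Hin ->] := In_map_inv Hu; apply: IH (Hin) (Ht _ Hin).
Qed.

Lemma term_over_subterm (V : Type) (u t : term F V) :
  subterm u t -> term_over Sg t -> term_over Sg u.
Proof. by elim=> [|f ts t' Hin _ IH] // /term_over_args[_ _ /(_ _ Hin)]. Qed.

End OverFacts.

Record automaton (F : Type) (Sg : signature F) := Automaton {
  state : Type;
  trans : F -> seq state -> state -> Prop;
  transP : forall f qs q, trans f qs q ->
    List.In f (sig_syms Sg) /\ size qs = sig_arity Sg f }.

Section Automata.
Variables (F : Type) (Sg : signature F).
Implicit Types A B : automaton Sg.

(* Terms over the symbols and, as nullary symbols, the states: [term F (state A)]. *)
Inductive rewrite_step A : term F (state A) -> term F (state A) -> Prop :=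
| rewrite_root f qs q :
    trans f qs q -> rewrite_step (App f (map Var qs)) (Var q)
| rewrite_arg f ts1 u v ts2 : rewrite_step u v ->
    rewrite_step (App f (ts1 ++ u :: ts2)) (App f (ts1 ++ v :: ts2)).

Definition reaches A (t : term F (state A)) (q : state A) : Prop :=
  clos_refl_trans _ (@rewrite_step A) t (Var q).

Definition ground_in A (s : gterm F) : term F (state A) :=
  tsubst (fun v : void => match v with end) s.

Definition deterministic A : Prop :=
  forall (s : gterm F) (q1 q2 : state A), term_over Sg s ->
    reaches (ground_in A s) q1 -> reaches (ground_in A s) q2 -> q1 = q2.

Definition reachable A : Prop :=
  forall q : state A, exists2 s : gterm F,
    term_over Sg s & reaches (ground_in A s) q.

Definition is_hom A B (h : state A -> state B) : Prop :=
  forall f qs q, trans f qs q -> trans f (map h qs) (h q).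

Definition hom_le A B : Prop := exists h : state A -> state B, is_hom h.

Definition isomorphic A B : Prop :=
  exists (h : state A -> state B) (k : state B -> state A),
    [/\ is_hom h, is_hom k, cancel h k & cancel k h].

Definition language A : set (gterm F) :=
  [set s | term_over Sg s /\ exists c : state A, reaches (ground_in A s) c].

End Automata.

Record egraph (F : Type) (Sg : signature F) := EGraph {
  egraph_automaton :> automaton Sg;
  egraph_det : deterministic egraph_automaton;
  egraph_reach : reachable egraph_automaton }.

Definition least_above (F : Type) (Sg : signature F) (J : Type)
    (A : J -> automaton Sg) (G : egraph Sg) : Prop :=
  (forall j, hom_le (A j) G) /\
  (forall H : egraph Sg, (forall j, hom_le (A j) H) -> hom_le G H).

Section Eval.
Variables (F : Type) (Sg : signature F).
Implicit Types A B : automaton Sg.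

(* Big-step form of [reaches]. *)
Inductive eval A : term F (state A) -> state A -> Prop :=
| eval_var q : eval (Var q) q
| eval_app f ts qs q :
    List.Forall2 (@eval A) ts qs -> trans f qs q -> eval (App f ts) q.

Lemma eval_var_inv A (q q' : state A) : eval (Var q) q' -> q' = q.
Proof. by move=> H; inversion H. Qed.

Lemma eval_app_inv A f ts (q : state A) : eval (App f ts) q ->
  exists2 qs, List.Forall2 (@eval A) ts qs & trans f qs q.
Proof. by move=> H; inversion H; subst; exists qs. Qed.

Lemma reaches_eval A t (q : state A) : reaches t q <-> eval t q.
Proof.
split.
- have vars qs : List.Forall2 (@eval A) (map Var qs) qs.
    elim: qs => [|p qs IH] /=; first exact: List.Forall2_nil.
    by apply: List.Forall2_cons => //; apply: eval_var.
  have step : forall u v, @rewrite_step _ _ A u v -> forall p, eval v p -> eval u p.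
    move=> u v; elim=> [f qs p Ht p' /eval_var_inv ->|f ts1 u' v' ts2 _ IH p].
      exact: eval_app (vars qs) Ht.
    move=> Hev; have [qs Hqs Ht] := eval_app_inv Hev; move: Hev => _; apply: eval_app Ht.
    elim: ts1 qs Hqs => [|t' ts1 IHts] qs /= H; inversion H; subst;
      apply: List.Forall2_cons => //; first exact: IH.
    exact: IHts.
  have star : forall u v, clos_refl_trans _ (@rewrite_step _ _ A) u v ->
      forall p, eval v p -> eval u p.
    move=> u v; elim=> [{}u {}v H p|//|u1 u2 u3 _ IH1 _ IH2 p H].
      exact: (step _ _ H p).
    exact: (IH1 _ (IH2 _ H)).
  by move=> H; apply: star H _ _; apply: eval_var.
- elim/term_nested_ind: t q => [v q /eval_var_inv ->|f ts IH q].
    exact: rt_refl.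
  move=> Hev; have [qs Hqs Ht] := eval_app_inv Hev; move: Hev => _.
  apply: (@rt_trans _ _ _ (App f (map Var qs))); last first.
    by apply: rt_step; apply: rewrite_root.
  have ctx : forall u v, clos_refl_trans _ (@rewrite_step _ _ A) u v ->
     forall ts1 ts2, clos_refl_trans _ (@rewrite_step _ _ A)
       (App f (ts1 ++ u :: ts2)) (App f (ts1 ++ v :: ts2)).
    move=> u v; elim=> [{}u {}v H|{}u|u1 u2 u3 _ I1 _ I2] ts1 ts2.
    + by apply: rt_step; apply: rewrite_arg.
    + exact: rt_refl.
    + exact: rt_trans (I1 _ _) (I2 _ _).
  suff: forall pre, clos_refl_trans _ (@rewrite_step _ _ A)
      (App f (pre ++ ts)) (App f (pre ++ map Var qs)) by move/(_ [::]).
  elim: Hqs IH => [|u p us ps Hu _ IHus] IH pre /=; first exact: rt_refl.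
  apply: rt_trans (ctx _ _ (IH u (or_introl erefl) _ Hu) _ _) _.
  rewrite -!cat_rcons; apply: IHus => t Hin; apply: IH; right; exact: Hin.
Qed.

Lemma eval_hom A B (h : state A -> state B) : is_hom h ->
  forall (s : gterm F) q, eval (ground_in A s) q -> eval (ground_in B s) (h q).
Proof.
move=> hh s; elim/term_nested_ind: s => [[]|f ts IH] q.
rewrite /ground_in /=; move=> Hev; have [qs Hqs Ht] := eval_app_inv Hev; move: Hev => _.
apply: (@eval_app _ _ _ (map h qs)); last exact: hh.
elim: ts qs Hqs IH {Ht} => [|t ts IHts] qs H IH; inversion H; subst => /=;
  first exact: List.Forall2_nil.
apply: List.Forall2_cons; first by apply: IH => //; left.
by apply: IHts => // u Hu; apply: IH; right.
Qed.

Lemma eval_over A (s : gterm F) (q : state A) :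
  eval (ground_in A s) q -> term_over Sg s.
Proof.
elim/term_nested_ind: s q => [[]|f ts IH] q.
rewrite /ground_in /=; move=> Hev; have [qs Hqs Ht] := eval_app_inv Hev; move: Hev => _.
have [Hf Hsz] := transP Ht.
apply/term_over_args; split=> //.
  rewrite -Hsz; apply: etrans (List.Forall2_length Hqs).
  by symmetry; exact: size_map.
move=> t; elim: ts qs Hqs IH {Ht Hsz} => [|t' ts IHts] qs H IH //=.
inversion H; subst => -[<-|Hin].
  by apply: (IH t') H2; left.
by apply: IHts H4 _ Hin => u Hu; apply: IH; right.
Qed.

Lemma egraph_eval_uniq (G : egraph Sg) s (q1 q2 : state G) :
  eval (ground_in G s) q1 -> eval (ground_in G s) q2 -> q1 = q2.
Proof.
move=> H1 H2; have Hs := eval_over H1.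
by apply: (egraph_det Hs); apply/reaches_eval.
Qed.

End Eval.

(* The states are the classes of the ground terms for "equal in every E-graph
   above the family". *)
Section LeastAbove.
Variables (F : Type) (Sg : signature F) (J : Type) (A : J -> automaton Sg).
Hypothesis A_reach : forall j, reachable (A j).

Let above (H : egraph Sg) := forall j, hom_le (A j) H.

Let eqv (s t : gterm F) : Prop :=
  [/\ term_over Sg s, term_over Sg t & forall H : egraph Sg, above H ->
    exists2 q : state H, eval (ground_in H s) q & eval (ground_in H t) q].

Let eqv_sym s t : eqv s t -> eqv t s.
Proof.
by case=> Hs Ht E; split=> // H /E[q ? ?]; exists q.
Qed.

Let eqv_trans s t u : eqv s t -> eqv t u -> eqv s u.
Proof.
case=> Hs Ht E [_ Hu E']; split=> // H aH.
have [q Hsq Htq] := E H aH; have [q' Htq' Huq'] := E' H aH.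
by exists q => //; rewrite (egraph_eval_uniq Htq Htq').
Qed.

Let cls (s : gterm F) : set (gterm F) := [set t | eqv s t].

Let cls_eq s t : eqv s t -> cls s = cls t.
Proof.
move=> E; apply/seteqP; split=> u /=; last exact: eqv_trans.
exact/eqv_trans/eqv_sym.
Qed.

Let cls_inv s t : eqv t t -> cls s = cls t -> eqv s t.
Proof. by move=> Ht E; have : cls t t by []; rewrite -E. Qed.

Let LState := {X : set (gterm F) | exists2 s, eqv s s & X = cls s}.

Let LState_inj (X Y : LState) : sval X = sval Y -> X = Y.
Proof.
by case: X Y => [X HX] [Y HY] /= E; subst Y; congr exist; apply: Prop_irrelevance.
Qed.

Let mkP s : eqv s s -> exists2 s', eqv s' s' & cls s = cls s'.
Proof. by move=> Hs; exists s. Qed.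

Let mk s (Hs : eqv s s) : LState := exist _ (cls s) (mkP Hs).

Let ltrans f (Xs : seq LState) (X : LState) : Prop :=
  exists ss, [/\ eqv (App f ss) (App f ss), sval X = cls (App f ss) &
    List.Forall2 (fun s (Y : LState) => eqv s s /\ sval Y = cls s) ss Xs].

Let ltransP f Xs X : ltrans f Xs X ->
  List.In f (sig_syms Sg) /\ size Xs = sig_arity Sg f.
Proof.
case=> ss [[/term_over_args[Hf Hsz _] _ _] _ E]; split=> //.
by rewrite -Hsz; symmetry; exact: (List.Forall2_length E).
Qed.

Let LG : automaton Sg := Automaton ltransP.

Let eqv_arg f ss s : eqv (App f ss) (App f ss) -> List.In s ss -> eqv s s.
Proof.
case=> /term_over_args[_ _ Ho] _ E Hin; split; [exact: Ho | exact: Ho |].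
move=> H /E[q + _]; rewrite /ground_in /= => Hev; have [qs Hqs _] := eval_app_inv Hev; move: Hev => _.
elim: ss qs Hqs Hin {Ho E} => [|s' ss IH] qs // Hqs; inversion Hqs; subst.
by case=> [<-|]; [exists y | apply: IH H4].
Qed.

Let eqv_congr f ss ss' : eqv (App f ss) (App f ss) ->
  List.Forall2 eqv ss ss' -> eqv (App f ss) (App f ss').
Proof.
case=> Ho _ E Hss; split=> //.
  move/term_over_args: Ho => [Hf Hsz _]; apply/term_over_args; split=> //.
    by rewrite -Hsz; symmetry; exact: (List.Forall2_length Hss).
  move=> t; elim: Hss => [|s s' us us' [_ Hs' _] _ IH] //= [<-|] //.
move=> H aH; have [q Hq _] := E H aH; exists q => //.
move: Hq; rewrite /ground_in /= => Hev; have [qs Hqs Ht] := eval_app_inv Hev; move: Hev => _.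
apply: eval_app Ht; move: qs Hqs.
elim: Hss => [|s s' us us' [_ _ /(_ H aH)[p Hp Hp']] _ IH] qs Hqs //=.
inversion Hqs; subst; apply: List.Forall2_cons; last exact: IH.
by rewrite (egraph_eval_uniq H2 Hp).
Qed.

Let LG_eval s (X : LState) :
  eval (ground_in LG s) (X : state LG) -> eqv s s /\ sval X = cls s.
Proof.
elim/term_nested_ind: s X => [[]|f ts IH] X.
rewrite /ground_in /= => Hev; have [Xs HXs [ss [Hss HX Hall]]] := eval_app_inv Hev; move: Hev => _.
have Hts : List.Forall2 eqv ss ts.
  move: Xs HXs ss Hall {Hss HX}.
  elim: ts IH => [|t ts IHts] IH Xs HXs ss Hall; inversion HXs; subst;
    inversion Hall; subst; first exact: List.Forall2_nil.
  have [Ht Ey] := IH t (or_introl erefl) _ H1.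
  case: H4 => _ Ey'; apply: List.Forall2_cons.
    by apply: cls_inv => //; rewrite -Ey -Ey'.
  by apply: (IHts _ _ H3) => // u Hu; apply: IH; right.
have E := eqv_congr Hss Hts; split; last by rewrite HX; apply: cls_eq.
exact: eqv_trans (eqv_sym E) E.
Qed.

Let LG_eval_ex s (Hs : eqv s s) : eval (ground_in LG s) (mk Hs : state LG).
Proof.
elim/term_nested_ind: s Hs => [[]|f ts IH] Hs.
have Ha := eqv_arg Hs.
have [Xs H1 H2] : exists2 Xs : seq LState,
    List.Forall2 (@eval _ _ LG) (map (ground_in LG) ts) Xs &
    List.Forall2 (fun s (Y : LState) => eqv s s /\ sval Y = cls s) ts Xs.
  elim: ts IH Ha {Hs} => [|t ts IHts] IH Ha.
    by exists [::]; apply: List.Forall2_nil.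
  have [||Xs H1 H2] := IHts.
  - by move=> u Hu; apply: IH; right.
  - by move=> u Hu; apply: Ha; right.
  have Ht := Ha t (or_introl erefl).
  exists (mk Ht :: Xs); last exact: List.Forall2_cons.
  by apply: List.Forall2_cons => //; apply: IH; left.
by apply: eval_app H1 _; exists ts.
Qed.

Lemma least_above_exists : exists G : egraph Sg, least_above A G.
Proof.
have det : deterministic LG.
  move=> s X Y _ /reaches_eval/LG_eval[_ EX] /reaches_eval/LG_eval[_ EY].
  by apply: LState_inj; rewrite EX EY.
have reach : reachable LG.
  move=> X; case: (svalP X) => s Hs EX; exists s; first by case: Hs.
  apply/reaches_eval; suff -> : X = mk Hs by exact: LG_eval_ex.
  exact: LState_inj.
exists (EGraph det reach); split.
- move=> j; have rep q : exists s, eval (ground_in (A j) s) q.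
    by have [s _ /reaches_eval] := A_reach q; exists s.
  have same q s t : eval (ground_in (A j) s) q -> eval (ground_in (A j) t) q ->
      eqv s t.
    move=> Es Et; split; [exact: eval_over Es | exact: eval_over Et |].
    by move=> H /(_ j)[h hh]; exists (h q); apply: eval_hom.
  pose r q := sval (cid (rep q)); have rP q := svalP (cid (rep q)).
  exists (fun q => mk (same q _ _ (rP q) (rP q))) => f qs q Ht.
  exists (map r qs).
  have Ef : eval (ground_in (A j) (App f (map r qs))) q.
    rewrite /ground_in /=; apply: eval_app Ht.
    elim: qs => [|p qs IH] /=; first exact: List.Forall2_nil.
    exact: (List.Forall2_cons _ _ (rP p) IH).
  split; first exact: (same _ _ _ Ef Ef).
    exact: (cls_eq (same q _ _ (rP q) Ef)).
  elim: qs {Ht Ef} => [|p qs IH] /=; first exact: List.Forall2_nil.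
  by apply: List.Forall2_cons => //; split=> //; exact: (same _ _ _ (rP p) (rP p)).
- move=> H aH.
  have val (X : LState) : exists q : state H,
      forall s, sval X s -> eval (ground_in H s) q.
    case: (svalP X) => s Hs ->; case: (Hs) => _ _ /(_ H aH)[q Hq _].
    exists q => t [_ _ /(_ H aH)[q' Hq' Ht]].
    by rewrite (egraph_eval_uniq Hq Hq').
  pose h X := sval (cid (val X)); have hP X := svalP (cid (val X)).
  exists h => f Xs X [ss [Hss EX Hall]].
  have : eval (ground_in H (App f ss)) (h X) by apply: hP; rewrite EX.
  rewrite /ground_in /= => Hev; have [qs Hqs Ht] := eval_app_inv Hev; move: Hev => _.
  suff <- : qs = map h Xs by [].
  elim: Hall qs Hqs {Hss Ht EX} => [|s Y us Ys [Hs EY] _ IH] qs Hqs /=;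
    inversion Hqs; subst => //.
  congr (_ :: _); last exact: IH.
  by apply: (egraph_eval_uniq H2); apply: hP; rewrite EY.
Qed.

End LeastAbove.

(* A least E-graph is unique only up to isomorphism; CC and egraph_sup pick a
   representative. *)
Definition CC (F : Type) (Sg : signature F) (A : automaton Sg)
    (hA : reachable A) : egraph Sg :=
  sval (cid (least_above_exists (fun _ : unit => hA))).

Definition egraph_sup (F : Type) (Sg : signature F) (G : nat -> egraph Sg) :
    egraph Sg :=
  sval (cid (least_above_exists (fun i => @egraph_reach _ _ (G i)))).

Lemma CC_least (F : Type) (Sg : signature F) (A : automaton Sg)
  (hA : reachable A) : least_above (fun _ : unit => A) (CC hA).
Proof. exact: svalP (cid _). Qed.

Lemma egraph_sup_least (F : Type) (Sg : signature F) (G : nat -> egraph Sg) :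
  least_above (fun i => G i : automaton Sg) (egraph_sup G).
Proof. exact: svalP (cid _). Qed.

Section Identify.
Variables (F : Type) (Sg : signature F) (A : automaton Sg).
Variable E : state A -> state A -> Prop.

Definition ident_class (p : state A) : set (state A) :=
  [set p' | clos_refl_sym_trans _ E p p'].

Definition ident_state : Type :=
  {X : set (state A) | exists p, X = ident_class p}.

Definition ident_proj (p : state A) : ident_state :=
  exist _ (ident_class p) (ex_intro _ p erefl).

Definition ident_trans f (Xs : seq ident_state) (X : ident_state) : Prop :=
  exists qs q, [/\ trans f qs q, Xs = map ident_proj qs & X = ident_proj q].

Lemma ident_transP f Xs X : ident_trans f Xs X ->
  List.In f (sig_syms Sg) /\ size Xs = sig_arity Sg f.
Proof. by case=> qs [q [Ht -> _]]; have := transP Ht; rewrite size_map. Qed.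

Definition identify : automaton Sg := Automaton ident_transP.

Lemma identify_hom : is_hom (ident_proj : state A -> state identify).
Proof. by move=> f qs q Ht; exists qs, q. Qed.

Lemma identify_reach : reachable A -> reachable identify.
Proof.
move=> hA [X [p EX]].
have -> : exist _ X (ex_intro _ p EX) = ident_proj p :> state identify.
  by subst X.
have [s Hs /reaches_eval Hp] := hA p; exists s => //.
exact/reaches_eval/(eval_hom identify_hom).
Qed.

End Identify.

Section Apply.
Variables (F : Type) (Sg : signature F) (R : trs Sg) (G : automaton Sg).
Implicit Types (r : term F nat * term F nat) (sg : nat -> state G).

Definition inst sg (t : term F nat) : term F (state G) :=
  tsubst (fun x => Var (sg x)) t.

Definition matches r sg (c : state G) : Prop :=
  List.In r (trs_rules R) /\ reaches (inst sg r.1) c.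

(* A map from Var(lhs) to the states is represented by the list of its values
   along [tvars lhs], so that total maps that agree on Var(lhs) share their
   fresh states. *)
Definition assignment r sg : seq (state G) := map sg (tvars r.1).

Record fresh_state := FreshState {
  fr_rule : term F nat * term F nat;
  fr_asg : seq (state G);
  fr_root : state G;
  fr_term : term F (state G);
  fr_valid : exists sg, [/\ matches fr_rule sg fr_root,
    fr_asg = assignment fr_rule sg,
    proper_subterm fr_term (inst sg fr_rule.2) & ~~ is_var fr_term] }.

(* [node r sg c u p]: the state q_u of the flattening of rhs[sg] with root c
   is p. *)
Inductive node r sg (c : state G) :
    term F (state G) -> state G + fresh_state -> Prop :=
| node_root : node r sg c (inst sg r.2) (inl c)
| node_state q : proper_subterm (Var q) (inst sg r.2) ->
    node r sg c (Var q) (inl q)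
| node_fresh (x : fresh_state) : fr_rule x = r ->
    fr_asg x = assignment r sg -> fr_root x = c ->
    node r sg c (fr_term x) (inr x).

Inductive flat_trans : F -> seq (state G + fresh_state) ->
    state G + fresh_state -> Prop :=
| flat_old f qs q : trans f qs q -> flat_trans f (map inl qs) (inl q)
| flat_new r sg c f us ps p : matches r sg c ->
    subterm (App f us) (inst sg r.2) ->
    List.Forall2 (node r sg c) us ps -> node r sg c (App f us) p ->
    flat_trans f ps p.

Lemma inst_over r sg : List.In r (trs_rules R) -> term_over Sg (inst sg r.2).
Proof. by move/(trs_rhs_over (t := R)); apply: term_over_subst. Qed.

Lemma flat_transP f ps p : flat_trans f ps p ->
  List.In f (sig_syms Sg) /\ size ps = sig_arity Sg f.
Proof.
case=> [{}f qs q Ht|r sg c {}f us {}ps {}p [Hr _] Hsub Hps _].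
  by have := transP Ht; rewrite size_map.
have /term_over_args[? <- _] := term_over_subterm Hsub (inst_over sg Hr).
by split=> //; symmetry; exact: (List.Forall2_length Hps).
Qed.

Definition flat_automaton : automaton Sg := Automaton flat_transP.

(* When rhs[sg] is a state, it is identified with the root c. *)
Inductive root_ident : state flat_automaton -> state flat_automaton -> Prop :=
| root_ident_var r sg c q : matches r sg c -> inst sg r.2 = Var q ->
    root_ident (inl q) (inl c).

Definition apply_trs : automaton Sg := identify root_ident.

Lemma flat_reach : reachable G -> reachable flat_automaton.
Proof.
move=> hG; have hl : is_hom (inl : state G -> state flat_automaton).
  by move=> f qs q; apply: flat_old.
have old (q : state G) : exists s, eval (ground_in flat_automaton s)
    (inl q : state flat_automaton).
  have [s _ /reaches_eval Hs] := hG q; exists s; exact: (eval_hom hl).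
suff all (p : state flat_automaton) :
    exists s, eval (ground_in flat_automaton s) p.
  move=> p; have [s Hs] := all p; exists s;
    [exact: (eval_over Hs) | exact/reaches_eval].
case: p => [q|x]; first exact: old.
case: x => r asg c u Hv; have [sg [Hm Ea _ _]] := Hv.
suff: forall v, proper_subterm v (inst sg r.2) ->
    exists p s, [/\ node r sg c v p,
      eval (ground_in flat_automaton s) (p : state flat_automaton) &
      forall H, v = u -> p = inr (@FreshState r asg c u H)].
  case/(_ u).
    have [sg' [_ Ea' Hu _]] := Hv.
    suff -> : inst sg r.2 = inst sg' r.2 by [].
    have agree x : x \in tvars r.2 -> sg x = sg' x.
      have Hin : {subset tvars r.2 <= tvars r.1}.
        by case: Hm => Hr _; exact: (trs_vars Hr).
      move/Hin => Hx; have := Ea; rewrite Ea' /assignment.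
      by move/eq_in_map => /(_ x Hx).
    move: agree; rewrite /inst; elim/term_nested_ind: (r.2) => [x|f ts IH] Hag /=.
      by rewrite Hag // inE.
    congr App; elim: ts IH Hag => [|t ts IHts] IH Hag //=; congr (_ :: _).
      by apply: IH; [left | move=> x Hx; apply: Hag; rewrite /= mem_cat Hx].
    apply: IHts => [v Hin|x Hx]; first by apply: IH; right.
    by apply: Hag; rewrite /= mem_cat; apply/orP; right.
  move=> p [s [_ Hs Ep]]; exists s; rewrite -(Ep Hv) //.
move=> v; elim/term_nested_ind: v => [q|f us IH] Hp.
  have [s Hs] := old q; exists (inl q), s; split=> //.
    exact: node_state.
  by move=> H E; exfalso; have [? [_ _ _]] := H; rewrite -E.
have Hsub : subterm (App f us) (inst sg r.2).
  by case: Hp => g ts t Hin; exact: (subterm_arg _ Hin).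
have Hargs t : List.In t us -> proper_subterm t (inst sg r.2).
  by move=> Hin; exact: (subterm_arg_proper Hin Hsub).
have [ps [ss [Hn He]]] : exists ps ss, List.Forall2 (node r sg c) us ps /\
    List.Forall2 (@eval _ _ flat_automaton)
      (map (ground_in flat_automaton) ss) ps.
  elim: us IH Hargs {Hp Hsub} => [|t us IHus] IH Hargs.
    by exists [::], [::]; split; apply: List.Forall2_nil.
  have [||ps [ss [Hn He]]] := IHus.
  - by move=> t' Ht' Hp'; apply: IH => //; right.
  - by move=> t' Ht'; apply: Hargs; right.
  have [p [s [Hnp Hs _]]] := IH t (or_introl erefl) (Hargs _ (or_introl erefl)).
  by exists (p :: ps), (s :: ss); split; apply: List.Forall2_cons.
have Hvalid : exists sg0, [/\ matches r sg0 c, asg = assignment r sg0,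
    proper_subterm (App f us) (inst sg0 r.2) & ~~ is_var (App f us)].
  by exists sg.
pose x := FreshState Hvalid.
have Hx : node r sg c (App f us) (inr x) by apply: (@node_fresh _ _ _ x).
exists (inr x), (App f ss); split=> //.
  by rewrite /ground_in /=; apply: eval_app He _; exact: flat_new Hm Hsub Hn Hx.
move=> H E; congr inr; rewrite /x; subst u; congr FreshState.
exact: Prop_irrelevance.
Qed.

Lemma apply_trs_reach : reachable G -> reachable apply_trs.
Proof. by move=> hG; apply/identify_reach/flat_reach. Qed.

End Apply.

Definition ICO (F : Type) (Sg : signature F) (R : trs Sg) (G : egraph Sg) :
    egraph Sg :=
  @CC _ _ (apply_trs R G) (apply_trs_reach (@egraph_reach _ _ G)).

Definition EqSat_egraph (F : Type) (Sg : signature F) (R : trs Sg)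
    (G : egraph Sg) : egraph Sg :=
  egraph_sup (fun i => iter i (ICO R) G).

Section TermGraph.
Variables (F : Type) (Sg : signature F) (t : ground_over Sg).

Definition tg_state : Type := {u : gterm F | subterm u (sval t)}.

Definition tg_trans (f : F) (qs : seq tg_state) (q : tg_state) : Prop :=
  sval q = App f (map sval qs).

Lemma tg_transP f qs q : tg_trans f qs q ->
  List.In f (sig_syms Sg) /\ size qs = sig_arity Sg f.
Proof.
move=> E; have := term_over_subterm (svalP q) (svalP t).
by rewrite E => /term_over_args[? + _]; rewrite size_map.
Qed.

Definition tg_automaton : automaton Sg := Automaton tg_transP.

Lemma tg_eval (s : gterm F) (q : state tg_automaton) :
  eval (ground_in tg_automaton s) q <-> s = sval q.
Proof.
split.
- elim/term_nested_ind: s q => [[]|f ts IH] q.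
  rewrite /ground_in /= => Hev; have [qs Hqs ->] := eval_app_inv Hev; move: Hev => _; congr App.
  elim: ts qs Hqs IH => [|t' ts IHts] qs Hqs IH; inversion Hqs; subst => //=.
  congr (_ :: _); first by apply: IH => //; left.
  by apply: IHts => // u Hu; apply: IH; right.
- case: q => u /= + E; rewrite -{u}E.
  elim/term_nested_ind: s => [[]|f ts IH] Hs.
  have [qs Eqs He] : exists2 qs : seq tg_state, ts = map sval qs &
      List.Forall2 (@eval _ _ tg_automaton) (map (ground_in tg_automaton) ts) qs.
    have Hargs u : List.In u ts -> subterm u (sval t).
      move=> Hin; have [g us v Hv Hu] := subterm_arg_proper Hin Hs.
      exact: (subterm_arg _ Hv Hu).
    elim: ts IH Hargs {Hs} => [|u ts IHts] IH Hargs.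
      by exists [::] => //; apply: List.Forall2_nil.
    have [||qs Eqs He] := IHts.
    + by move=> v Hv Hs; apply: IH; right.
    + by move=> v Hv; apply: Hargs; right.
    have Hu := Hargs u (or_introl erefl).
    exists (exist _ u Hu :: qs); first by rewrite /= -Eqs.
    by apply: List.Forall2_cons => //; apply: IH; left.
  by rewrite /ground_in /=; apply: eval_app He _; rewrite /= /tg_trans /= -Eqs.
Qed.

Lemma tg_det : deterministic tg_automaton.
Proof.
move=> s [u Hu] [v Hv] _ /reaches_eval/tg_eval /= Eu /reaches_eval/tg_eval /= Ev.
by subst s v; rewrite (Prop_irrelevance Hu Hv).
Qed.

Lemma tg_reach : reachable tg_automaton.
Proof.
move=> q; exists (sval q); first exact: term_over_subterm (svalP q) (svalP t).
exact/reaches_eval/tg_eval.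
Qed.

Definition term_egraph : egraph Sg := EGraph tg_det tg_reach.

End TermGraph.

Definition EqSat (F : Type) (Sg : signature F) (R : trs Sg)
    (t : ground_over Sg) : egraph Sg :=
  EqSat_egraph R (term_egraph t).

Definition EqSat_terminates (F : Type) (Sg : signature F) (R : trs Sg)
    (t : ground_over Sg) : Prop :=
  exists n, isomorphic (ICO R (iter n (ICO R) (term_egraph t)))
                       (iter n (ICO R) (term_egraph t)).

Record schema := Schema {
  rel : finType;
  rel_arity : rel -> nat }.

Definition atom (S : schema) (V : Type) : Type := (rel S * seq V)%type.

Definition atom_wf (S : schema) (V : Type) (a : atom S V) : Prop :=
  size a.2 = rel_arity a.1.

Definition atom_map (S : schema) (V W : Type) (h : V -> W) (a : atom S V) :
  atom S W := (a.1, map h a.2).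

(* body(x, y) -> exists z, head(x, z); conjunctions are lists of atoms, and the
   order of x is the argument order of the Skolem functions. *)
Record tgd (S : schema) := Tgd {
  tgd_x : seq nat;
  tgd_y : seq nat;
  tgd_z : seq nat;
  tgd_body : seq (atom S nat);
  tgd_head : seq (atom S nat) }.

Definition atoms_vars (S : schema) (s : seq (atom S nat)) : seq nat :=
  flatten (map snd s).

(* The universally quantified variables are those of the body. *)
Definition tgd_wf (S : schema) (d : tgd S) : Prop :=
  [/\ uniq (tgd_x d ++ tgd_y d ++ tgd_z d),
      forall a, List.In a (tgd_body d ++ tgd_head d) -> atom_wf a,
      tgd_x d ++ tgd_y d =i atoms_vars (tgd_body d) &
      {subset atoms_vars (tgd_head d) <= tgd_x d ++ tgd_z d}].

(* Relation symbols, Skolem functions f^d_z, domain elements, and a supply of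
   further symbols. *)
Inductive symbol (S : schema) (D : Type) : Type :=
| RelSym of rel S
| SkSym of tgd S & nat
| DomSym of D
| AuxSym of nat.
Arguments RelSym {S D} _.
Arguments SkSym {S D} _ _.
Arguments DomSym {S D} _.
Arguments AuxSym {S D} _.

Section Chase.
Variables (S : schema) (D : Type).

Definition value : Type := gterm (symbol S D).

Definition fact : Type := atom S value.

Definition skolem_term (d : tgd S) (v : nat) : term (symbol S D) nat :=
  if v \in tgd_z d then App (SkSym d v) (map Var (tgd_x d)) else Var v.

Definition skolem_head (d : tgd S) : seq (atom S (term (symbol S D) nat)) :=
  map (atom_map (skolem_term d)) (tgd_head d).

Definition initial_facts (I : seq (atom S D)) : set fact :=
  [set a | exists2 b, List.In b I &
     a = atom_map (fun e => App (DomSym e) [::]) b].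

Definition chase_step (Gm : seq (tgd S)) (J : set fact) : set fact :=
  J `|` [set a | exists d (sg : nat -> value),
    [/\ List.In d Gm,
        forall b, List.In b (tgd_body d) -> J (atom_map sg b) &
        exists2 h, List.In h (skolem_head d) & a = atom_map (tsubst sg) h]].

Definition SklCh (Gm : seq (tgd S)) (I : seq (atom S D)) : set fact :=
  smallest (fun J => chase_step Gm J = J) (initial_facts I).

Definition SklCh_terminates (Gm : seq (tgd S)) (I : seq (atom S D)) : Prop :=
  exists n, iter n (chase_step Gm) (initial_facts I) = SklCh Gm I.

Definition signature_for (Gm : seq (tgd S)) (I : seq (atom S D))
    (Sg : signature (symbol S D)) : Prop :=
  [/\ forall R, List.In (RelSym R) (sig_syms Sg) /\
        sig_arity Sg (RelSym R) = rel_arity R,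
      forall d z, List.In d Gm -> z \in tgd_z d ->
        List.In (SkSym d z) (sig_syms Sg) /\
        sig_arity Sg (SkSym d z) = size (tgd_x d) &
      forall a e, List.In a I -> List.In e a.2 ->
        List.In (DomSym e) (sig_syms Sg) /\ sig_arity Sg (DomSym e) = 0].

Definition xi (Sg : signature (symbol S D)) (G : egraph Sg) : set fact :=
  [set a | language G (App (RelSym a.1) a.2)].

End Chase.

(* Main.v *)
(* Values of the chase become E-graph states of their own, and all facts share
   the state of a constant [top], so that a set of facts can be matched by one
   pattern: [top -> conj top top] puts conjunctions into that state, a rule
   [top -> A] seeds each initial fact [A], and a dependency with body
   [B1, ..., Bn] becomes one rule
   [conj B1 (... (conj Bn (conj top top))) -> A] per Skolemized head atom [A].
   The pattern matches exactly at [top] under assignments whose body atoms are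
   facts, hence the graph after [n + 1] rounds represents the [n]-th stage of the
   chase. *)
Require Import Defs.
From mathcomp Require Import all_boot.
From mathcomp Require Import boolp classical_sets.
From Stdlib Require List.
From Stdlib Require Import Relation_Operators.

Set Implicit Arguments.
Unset Strict Implicit.
Unset Printing Implicit Defensive.

Local Open Scope classical_set_scope.

(** * Pointwise relations between lists, and membership *)

Section Lists.
Variables (A B C : Type).

Lemma Forall2_map_l (P : B -> C -> Prop) (g : A -> B) s t :
  List.Forall2 P (map g s) t <-> List.Forall2 (fun x => P (g x)) s t.
Proof.
by elim: s t => [|x s IH] t /=; split=> H; inversion H; subst;
  constructor=> //; apply/IH.
Qed.

Lemma Forall2_map_r (P : A -> C -> Prop) (g : B -> C) s t :
  List.Forall2 P s (map g t) <-> List.Forall2 (fun x y => P x (g y)) s t.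
Proof.
by elim: t s => [|x t IH] s /=; split=> H; inversion H; subst;
  constructor=> //; apply/IH.
Qed.

Lemma Forall2_impl_in (P Q : A -> B -> Prop) s t :
  (forall x y, List.In x s -> P x y -> Q x y) ->
  List.Forall2 P s t -> List.Forall2 Q s t.
Proof.
move=> H E; elim: E H => [|x y s' t' Hxy _ IH] H; constructor.
  by apply: H => //; left.
by apply: IH => u v Hu; apply: H; right.
Qed.

Lemma Forall2_uniq (P Q : A -> B -> Prop) s t t' :
  (forall x y y', List.In x s -> P x y -> Q x y' -> y = y') ->
  List.Forall2 P s t -> List.Forall2 Q s t' -> t = t'.
Proof.
move=> H E; elim: E t' H => [|x y s' u Hxy _ IH] t' H E'; inversion E'; subst => //.
congr (_ :: _); first by apply: (H x) => //; left.
by apply: IH => // ? ? ? Hi; apply: H; right.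
Qed.

Lemma Forall2_ex (P : A -> B -> Prop) s :
  (forall x, List.In x s -> exists y, P x y) ->
  exists t, List.Forall2 P s t.
Proof.
elim: s => [|x s IH] H; first by exists [::]; constructor.
have [|t Ht] := IH; first by move=> y Hy; apply: H; right.
by have [y Hy] := H x (or_introl erefl); exists (y :: t); constructor.
Qed.

Lemma Forall2_in_l (P : A -> B -> Prop) s t x :
  List.Forall2 P s t -> List.In x s -> exists2 y, List.In y t & P x y.
Proof.
elim=> [|a b s' t' Hab _ IH] //= [<-|/IH[y Hy ?]]; first by exists b; [left|].
by exists y => //; right.
Qed.

End Lists.

Lemma Forall2_refl_in (A : Type) (P : A -> A -> Prop) s :
  (forall x, List.In x s -> P x x) -> List.Forall2 P s s.
Proof.
elim: s => [|x s IH] H; constructor; first by apply: H; left.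
by apply: IH => y Hy; apply: H; right.
Qed.

Lemma In_mem (T : eqType) (x : T) s : List.In x s <-> x \in s.
Proof.
elim: s => [|y s IH] //=; rewrite inE; split.
  by case=> [->|/IH ->]; rewrite ?eqxx ?orbT.
by case/orP => [/eqP ->|/IH]; [left|right].
Qed.

Lemma In_cat (A : Type) (x : A) s t :
  List.In x (s ++ t) <-> List.In x s \/ List.In x t.
Proof. exact: List.in_app_iff. Qed.

Lemma In_flatten (A : Type) (x : A) ss :
  List.In x (flatten ss) <-> exists2 s, List.In s ss & List.In x s.
Proof.
elim: ss => [|s ss IH] /=; first by split=> // -[].
rewrite In_cat IH; split.
  by case=> [H|[s' ? ?]]; [exists s; [left|] | exists s'; [right|]].
by case=> s' [<-|H] Hx; [left | right; exists s'].
Qed.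

Lemma In_mapP (A B : Type) (g : A -> B) s b :
  List.In b (map g s) <-> exists2 a, List.In a s & b = g a.
Proof. by split=> [|[a Ha ->]]; [exact: In_map_inv | exact: In_map]. Qed.

Lemma tvars_arg (F V : Type) f (ts : seq (term F V)) t v :
  List.In t ts -> List.In v (tvars t) -> List.In v (tvars (App f ts)).
Proof. by move=> Ht Hv; apply/In_flatten; exists (tvars t) => //; apply: In_map. Qed.

(** * Evaluation with states as leaves, the homomorphism order, and quotients *)

Section Automata.
Variables (F : Type) (Sg : signature F).
Implicit Types A B : automaton Sg.
Implicit Types G H : egraph Sg.

Definition mapv A B (h : state A -> state B) (t : term F (state A)) :
  term F (state B) := tsubst (fun q => Var (h q)) t.

Lemma mapv_inst A B (h : state A -> state B) (sg : nat -> state A) t :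
  mapv h (inst sg t) = inst (h \o sg) t.
Proof.
elim/term_nested_ind: t => [v|f ts IH] //=.
rewrite /mapv /inst /=; congr App; rewrite -map_comp.
elim: ts IH => [|t ts IHts] IH //=; congr (_ :: _); first by apply: IH; left.
by apply: IHts => u Hu; apply: IH; right.
Qed.

Lemma eval_appP A f ts (q : state A) :
  eval (App f ts) q <-> exists2 qs, List.Forall2 (@eval _ _ A) ts qs & trans f qs q.
Proof. by split=> [|[qs H1 H2]]; [exact: eval_app_inv | exact: eval_app H1 H2]. Qed.

Lemma eval_ground_app A f ss (q : state A) :
  eval (ground_in A (App f ss)) q <->
  exists2 qs, List.Forall2 (fun s => eval (ground_in A s)) ss qs & trans f qs q.
Proof.
by rewrite /ground_in /= eval_appP; split=> -[qs /Forall2_map_l ? ?]; exists qs => //;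
  apply/Forall2_map_l.
Qed.

Lemma eval_mapv A B (h : state A -> state B) : is_hom h ->
  forall t q, eval t q -> eval (mapv h t) (h q).
Proof.
move=> hh; elim/term_nested_ind => [v q /eval_var_inv ->|f ts IH q].
  exact: eval_var.
move=> /eval_appP[qs Hqs Ht]; apply/eval_appP; exists (map h qs); last exact: hh.
by apply/Forall2_map_l/Forall2_map_r; apply: (Forall2_impl_in _ Hqs) => t p Hin; exact: IH.
Qed.

Lemma eval_subterm A (s u : gterm F) (q : state A) :
  subterm u s -> eval (ground_in A s) q -> exists p, eval (ground_in A u) p.
Proof.
move=> Hu; elim: Hu q => [q Hq|f ts t Hin _ IH q]; first by exists q.
move=> /eval_ground_app[qs Hqs _]; have [p _ Hp] := Forall2_in_l Hqs Hin; exact: IH Hp.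
Qed.

(** Determinism speaks of ground terms only; by reachability each state in [t] can be replaced by a
    ground term that evaluates to it. *)
Lemma egraph_open_uniq G t (q1 q2 : state G) : eval t q1 -> eval t q2 -> q1 = q2.
Proof.
have rep (q : state G) : exists s, eval (ground_in G s) q.
  by have [s _ /reaches_eval] := egraph_reach q; exists s.
pose r q := sval (cid (rep q)).
suff E p : eval t p -> eval (ground_in G (tsubst r t)) p.
  by move=> /E H1 /E H2; apply: egraph_eval_uniq H1 H2.
elim/term_nested_ind: t p => [q p /eval_var_inv ->|f ts IH p].
  exact: (svalP (cid (rep q))).
move=> /eval_appP[qs Hqs Ht]; apply/eval_ground_app; exists qs => //.
by apply/Forall2_map_l; apply: (Forall2_impl_in _ Hqs) => t' p' Hin; exact: IH.
Qed.

(** Bridge between the chase, which assigns values to variables, and rewriting, which assigns states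
    to them. *)
Lemma eval_inst G (s : nat -> gterm F) (g : nat -> state G) t q :
  (forall x, List.In x (tvars t) -> eval (ground_in G (s x)) (g x)) ->
  eval (ground_in G (tsubst s t)) q <-> eval (inst g t) q.
Proof.
elim/term_nested_ind: t q => [x q /(_ x (or_introl erefl)) Hx|f ts IH q Hv].
  split=> [Hq|/eval_var_inv -> //]; rewrite (egraph_eval_uniq Hq Hx).
  exact: eval_var.
have {}IH t p : List.In t ts ->
    eval (ground_in G (tsubst s t)) p <-> eval (inst g t) p.
  by move=> Ht; apply: IH => // x Hx; apply: Hv; apply: tvars_arg Ht Hx.
rewrite /inst /= eval_ground_app eval_appP; split=> -[qs Hqs Ht]; exists qs => //.
  apply/Forall2_map_l; move/Forall2_map_l: Hqs; apply: Forall2_impl_in => t p Hin.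
  by rewrite IH.
apply/Forall2_map_l; move/Forall2_map_l: Hqs; apply: Forall2_impl_in => t p Hin.
by move=> ?; apply/IH.
Qed.

Lemma hom_le_trans A B (C : automaton Sg) : hom_le A B -> hom_le B C -> hom_le A C.
Proof.
by move=> [h hh] [k hk]; exists (k \o h) => f qs q /hh /hk; rewrite -map_comp.
Qed.

(** Homomorphisms preserve evaluation, so a round trip sends a state to one reached by the same
    ground term; determinism makes it the same state. *)
Lemma hom_le_antisym G H : hom_le G H -> hom_le H G -> isomorphic G H.
Proof.
have inv (G1 G2 : egraph Sg) (h : state G1 -> state G2) (k : state G2 -> state G1) :
    is_hom h -> is_hom k -> cancel h k.
  move=> hh hk q; have [s _ /reaches_eval Hs] := egraph_reach q.
  exact: egraph_eval_uniq (eval_hom hk (eval_hom hh Hs)) Hs.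
by move=> [h hh] [k hk]; exists h, k; split=> //; apply: inv.
Qed.

Lemma language_hom A B : hom_le A B -> language A `<=` language B.
Proof.
move=> [h hh] s [Hs [q /reaches_eval Hq]]; split=> //; exists (h q).
exact/reaches_eval/eval_hom.
Qed.

(** Universal property of the quotient: [h] is constant on classes, so it can be read off any
    representative. *)
Lemma identify_le A B (E : state A -> state A -> Prop) (h : state A -> state B) :
  is_hom h -> (forall p q, E p q -> h p = h q) -> hom_le (identify E) B.
Proof.
move=> hh hE.
have cst p q : clos_refl_sym_trans _ E p q -> h p = h q.
  by elim=> [{}p {}q /hE| |{}p {}q _ ->|p1 p2 p3 _ -> _ ->].
pose k (X : ident_state E) := h (sval (cid (svalP X))).
have kE p : k (ident_proj E p) = h p.
  rewrite /k; case: cid => p' /= /seteqP[/(_ p) + _].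
  by move/(_ (rst_refl _ _ _)) => /= /cst.
exists k => f _ _ [qs [q [Ht -> ->]]]; rewrite kE -map_comp.
by rewrite (eq_map kE); apply: hh.
Qed.

End Automata.

(** * The universal property of one round of equality saturation *)

Section ICO.
Variables (F : Type) (Sg : signature F) (R : trs Sg).
Implicit Types G H : egraph Sg.

(** Only matches found in [G] are required to have their right-hand sides in [H]; [H] may have
    further matches whose right-hand sides it lacks. [ICO R G] is the least such [H]. *)
Definition closed_along G H (h : state G -> state H) : Prop :=
  is_hom h /\ forall r sg c, matches R r sg c -> eval (inst (h \o sg) r.2) (h c).

Lemma proper_subtermW (V : Type) (t u : term F V) :
  proper_subterm t u -> subterm t u.
Proof. by case=> f ts v Hv Ht; apply: subterm_arg Hv Ht. Qed.

Lemma eval_open_subterm G (t u : term F (state G)) q :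
  subterm u t -> eval t q -> exists p, eval u p.
Proof.
move=> Hu; elim: Hu q => [q Hq|f ts v Hin _ IH q]; first by exists q.
move=> /eval_appP[qs Hqs _]; have [p _ Hp] := Forall2_in_l Hqs Hin; exact: IH Hp.
Qed.

Lemma subterm_mapv G H (h : state G -> state H) t u :
  subterm u t -> subterm (mapv h u) (mapv h t).
Proof.
elim=> [|f ts v Hin _ IH]; first exact: subterm_refl.
by apply: subterm_arg IH; apply: In_map.
Qed.

(** A fresh state is sent to the state of its term in [H]. Determinism of [H] makes these choices
    agree with the transitions of the flattening. *)
Lemma ICO_least G H (h : state G -> state H) :
  closed_along h -> hom_le (ICO R G) H.
Proof.
case=> hh hR; apply: (CC_least (apply_trs_reach (R := R) (@egraph_reach _ _ G))).2 => _.
(* The term of a fresh state is a subterm of an instantiated right-hand side, which evaluates in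
   [H]. *)
have val (x : fresh_state R G) : exists p, eval (mapv h (fr_term x)) p.
  have [sg [Hm _ /proper_subtermW/(subterm_mapv h) Hs _]] := fr_valid x.
  by apply: eval_open_subterm Hs _; rewrite mapv_inst; apply: hR Hm.
pose k (p : state G + fresh_state R G) :=
  match p with inl q => h q | inr x => sval (cid (val x)) end.
apply: (@identify_le _ _ (flat_automaton R G) _ _ k); last first.
  move=> _ _ [r sg c q Hm E] /=; have := hR _ _ _ Hm.
  by rewrite -mapv_inst E => /eval_var_inv.
have nodeE r sg c u p : matches R r sg c -> node (R := R) r sg c u p ->
    eval (mapv h u) (k p).
  move=> Hm [|q _|x _ _ _] /=; first by rewrite mapv_inst; apply: hR Hm.
    exact: eval_var.
  exact: (svalP (cid (val x))).
move=> f _ _ [{}f qs q Ht|r sg c {}f us ps p Hm _ Hus /(nodeE _ _ _ _ _ Hm)].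
  by rewrite -map_comp; apply: hh.
move/eval_appP=> [qs /Forall2_map_l Hqs Ht].
suff -> : map k ps = qs by [].
have {}Hus : List.Forall2 (fun u => eval (mapv h u)) us (map k ps).
  by apply/Forall2_map_r; apply: (Forall2_impl_in _ Hus) => u p' _; apply: nodeE.
by apply: Forall2_uniq Hus Hqs => u q q' _; apply: egraph_open_uniq.
Qed.

(** By induction every proper subterm of the right-hand side evaluates to the image of its node. The
    homomorphism [k] is arbitrary, so that it may also pass through the identification and the
    congruence closure. *)
Lemma flat_hom_eval G H (k : state (flat_automaton R G) -> state H) r sg c :
  is_hom k -> matches R r sg c -> ~~ is_var (inst sg r.2) ->
  eval (inst (k \o inl \o sg) r.2) (k (inl c)).
Proof.
move=> hk Hm Hvar; pose h := k \o inl.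
have sub u : proper_subterm u (inst sg r.2) ->
    exists2 p, node (R := R) r sg c u p & eval (mapv h u) (k p).
  elim/term_nested_ind: u => [q|f us IH] Hu.
    by exists (inl q); [apply: node_state | apply: eval_var].
  (* A subterm that is not a state gets the fresh state indexed by the rule, the assignment, the
     root and the subterm. *)
  have Hvalid : exists sg0, [/\ matches R r sg0 c, assignment r sg = assignment r sg0,
      proper_subterm (App f us) (inst sg0 r.2) & ~~ is_var (App f us)] by exists sg.
  pose x := FreshState Hvalid.
  have Hx : node (R := R) r sg c (App f us) (inr x) by apply: (@node_fresh _ _ _ _ _ _ _ x).
  have [ps Hps] : exists ps, List.Forall2 (fun u p => node (R := R) r sg c u p /\
      eval (mapv h u) (k p)) us ps.
    apply: Forall2_ex => u Hin; have [|p ? ?] := IH u Hin; last by exists p.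
    exact: (subterm_arg_proper Hin (proper_subtermW Hu)).
  exists (inr x) => //; apply/eval_appP; exists (map k ps).
    by apply/Forall2_map_l/Forall2_map_r; apply: (Forall2_impl_in _ Hps) => u p _ [].
  apply: hk; apply: flat_new Hm (proper_subtermW Hu) _ Hx.
  by apply: (Forall2_impl_in _ Hps) => u p _ [].
rewrite -[_ \o sg]/(h \o sg) -mapv_inst.
(* The whole right-hand side is treated apart from its proper subterms: its node is [c] itself, not
   a fresh state. *)
case E: (inst sg r.2) Hvar sub => [//|f us] _ sub.
have [ps Hps] : exists ps, List.Forall2 (fun u p => node (R := R) r sg c u p /\
    eval (mapv h u) (k p)) us ps.
  apply: Forall2_ex => u Hin; have [|p ? ?] := sub u; last by exists p.
  exact: proper_subterm_arg Hin (subterm_refl _).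
apply/eval_appP; exists (map k ps).
  by apply/Forall2_map_l/Forall2_map_r; apply: (Forall2_impl_in _ Hps) => u p _ [].
apply: hk; apply: (flat_new Hm (f := f) (us := us)).
- rewrite E; exact: subterm_refl.
- by apply: (Forall2_impl_in _ Hps) => u p _ [].
- rewrite -E; exact: node_root.
Qed.

Lemma ICO_closed G : exists h : state G -> state (ICO R G), closed_along h.
Proof.
have [k0 hk0] := (CC_least (apply_trs_reach (R := R) (@egraph_reach _ _ G))).1 tt.
pose pr : state (flat_automaton R G) -> state (apply_trs R G) :=
  ident_proj (root_ident (R := R) (G := G)).
pose k : state (flat_automaton R G) -> state (ICO R G) := k0 \o pr.
have hk : is_hom k.
  by move=> f qs q Ht; rewrite /k map_comp; apply: hk0; apply: identify_hom.
have kE p q : root_ident (R := R) (G := G) p q -> k p = k q.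
  move=> Hpq; congr k0; apply: eq_exist; apply/seteqP; split=> u /= Hu.
    by apply: rst_trans Hu; apply: rst_sym; apply: rst_step.
  by apply: rst_trans Hu; apply: rst_step.
exists (k \o inl); split=> [f qs q Ht|r sg c Hm].
  by rewrite map_comp; apply: hk; apply: flat_old.
(* A right-hand side that is a state adds no transition; its claim comes from the identification
   [kE]. *)
case: (boolP (is_var (inst sg r.2))) => Hvar; last exact: flat_hom_eval.
case E: (inst sg r.2) Hvar => [q|//] _.
rewrite -mapv_inst E /= -(kE _ _ (root_ident_var Hm E)).
exact: eval_var.
Qed.

End ICO.

(** * The encoding: signature, rewriting rules and start term *)

Section Encoding.
Variables (S : schema) (D : Type) (Gm : seq (tgd S)) (I : seq (atom S D)).
Hypothesis Gm_wf : forall d, List.In d Gm -> tgd_wf d.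
Hypothesis I_wf : forall a, List.In a I -> atom_wf a.

Local Notation sym := (symbol S D).
Implicit Types (V : Type) (J : set (fact S D)).

(** Doubling the index makes [AuxSym 0] nullary, for [top], and [AuxSym 1] binary, for [conj]. *)
Definition enc_arity (f : sym) : nat :=
  match f with
  | RelSym r => rel_arity r
  | SkSym d _ => size (tgd_x d)
  | DomSym _ => 0
  | AuxSym n => n.*2
  end.

Definition value_syms : seq sym :=
  flatten [seq [seq SkSym d z | z <- tgd_z d] | d <- Gm] ++
  [seq DomSym e | e <- flatten (map snd I)].

(** Keeping relation and auxiliary symbols out of values lets the root symbol of a term tell values
    from facts. *)
Definition value_sig : signature sym := Signature value_syms enc_arity.

Definition enc_sig : signature sym :=
  Signature (AuxSym 0 :: AuxSym 1 :: map RelSym (enum (Defs.rel S)) ++ value_syms)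
    enc_arity.

Lemma value_syms_sk d z : List.In d Gm -> z \in tgd_z d ->
  List.In (SkSym d z : sym) value_syms.
Proof.
move=> Hd /In_mem Hz; apply/In_cat; left; apply/In_flatten.
exists [seq SkSym d z | z <- tgd_z d]; last exact: In_map.
exact: (In_map (fun d => [seq SkSym d z | z <- tgd_z d])).
Qed.

Lemma value_syms_dom a e : List.In a I -> List.In e a.2 ->
  List.In (DomSym e) value_syms.
Proof.
move=> Ha He; apply/In_cat; right; apply: In_map; apply/In_flatten.
by exists a.2 => //; apply: In_map.
Qed.

Lemma enc_sig_rel r : List.In (RelSym r) (sig_syms enc_sig).
Proof.
by right; right; apply/In_cat; left; apply: In_map; apply/In_mem; rewrite mem_enum.
Qed.

Lemma enc_sig_value f : List.In f value_syms -> List.In f (sig_syms enc_sig).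
Proof. by move=> Hf; right; right; apply/In_cat; right. Qed.

Definition is_value_sym (f : sym) : bool :=
  match f with SkSym _ _ | DomSym _ => true | _ => false end.

Lemma value_syms_is f : List.In f value_syms -> is_value_sym f.
Proof.
move=> /In_cat[/In_flatten[s /In_mapP[d _ ->] /In_mapP[z _ ->]] //|].
by move=> /In_mapP[e _ ->].
Qed.

Lemma term_over_value V (t : term sym V) :
  term_over value_sig t -> term_over enc_sig t.
Proof.
elim/term_nested_ind: t => [//|f ts IH] /term_over_args[Hf Hs Ht].
apply/term_over_args; split=> //; first exact: enc_sig_value.
by move=> t Hin; apply: IH => //; apply: Ht.
Qed.

Definition top {V} : term sym V := App (AuxSym 0) [::].
Definition conj {V} (s t : term sym V) : term sym V := App (AuxSym 1) [:: s; t].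
Definition atom_term {V} (a : atom S (term sym V)) : term sym V :=
  App (RelSym a.1) a.2.

Definition dom_atom {V} (b : atom S D) : atom S (term sym V) :=
  atom_map (fun e => App (DomSym e) [::]) b.

(* The innermost [conj top top] keeps a dependency with an empty body from
   firing on the graph of [top] alone, so that rounds of equality saturation and
   of the chase stay aligned. *)
Definition body_term (d : tgd S) : term sym nat :=
  foldr (fun a t => conj (atom_term (atom_map Var a)) t) (conj top top)
    (tgd_body d).

Definition enc_rules : seq (term sym nat * term sym nat) :=
  (top, conj top top) :: [seq (top, atom_term (dom_atom b)) | b <- I] ++
  flatten [seq [seq (body_term d, atom_term h) | h <- skolem_head D d] | d <- Gm].

Lemma enc_rulesP r : List.In r enc_rules <->
  [\/ r = (top, conj top top),
      exists2 b, List.In b I & r = (top, atom_term (dom_atom b)) |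
      exists d h, [/\ List.In d Gm, List.In h (skolem_head D d) &
        r = (body_term d, atom_term h)]].
Proof.
split.
- case=> [<-|/In_cat[/In_mapP[b Hb ->]|/In_flatten[s /In_mapP[d Hd ->]]]].
  + exact: Or31.
  + by apply: Or32; exists b.
  + by move=> /In_mapP[h Hh ->]; apply: Or33; exists d, h.
- case=> [->|[b Hb ->]|[d [h [Hd Hh ->]]]]; first by left.
  + by right; apply/In_cat; left; apply: (In_map (fun b => (top, atom_term (dom_atom b)))).
  + right; apply/In_cat; right; apply/In_flatten.
    exists [seq (body_term d, atom_term h) | h <- skolem_head D d].
      exact: (In_map (fun d => [seq (body_term d, atom_term h) | h <- skolem_head D d])).
    exact: (In_map (fun h => (body_term d, atom_term h))).
Qed.

Lemma top_over V : term_over enc_sig (top : term sym V).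
Proof. by apply/term_over_args; split=> //; left. Qed.

Lemma conj_over V (s t : term sym V) :
  term_over enc_sig s -> term_over enc_sig t -> term_over enc_sig (conj s t).
Proof.
move=> Hs Ht; apply/term_over_args; split=> //; first by right; left.
by move=> u [<-|[<-|[]]].
Qed.

Lemma atom_term_over V (a : atom S (term sym V)) : atom_wf a ->
  (forall u, List.In u a.2 -> term_over value_sig u) ->
  term_over enc_sig (atom_term a).
Proof.
move=> Ha Hu; apply/term_over_args; split=> //; first exact: enc_sig_rel.
by move=> u Hin; apply/term_over_value/Hu.
Qed.

Lemma dom_atom_good V (b : atom S D) : List.In b I ->
  atom_wf (dom_atom b : atom S (term sym V)) /\
  forall u, List.In u (dom_atom b : atom S (term sym V)).2 -> term_over value_sig u.
Proof.
move=> Hb; split; first by rewrite /atom_wf size_map; apply: I_wf.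
move=> u /In_mapP[e He ->]; apply/term_over_args; split=> //.
exact: value_syms_dom Hb He.
Qed.

(** A head variable is either existential, and becomes a Skolem term over [tgd_x d], or lies in
    [tgd_x d] itself; [tgd_x d] occurs in the body. *)
Lemma skolem_head_good d h : List.In d Gm -> List.In h (skolem_head D d) ->
  atom_wf h /\ forall u, List.In u h.2 -> term_over value_sig u /\
    {subset tvars u <= atoms_vars (tgd_body d)}.
Proof.
move=> Hd /In_mapP[a Ha ->]; have [_ Hwf Hbody Hhead] := Gm_wf Hd.
split.
  by rewrite /atom_wf size_map; apply: Hwf; apply/In_cat; right.
move=> u /In_mapP[x Hx ->]; rewrite /skolem_term.
have xb y : y \in tgd_x d -> y \in atoms_vars (tgd_body d).
  by rewrite -Hbody mem_cat => ->.
case: ifP => Hz.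
  split.
    apply/term_over_args; split; [exact: value_syms_sk | exact: size_map |].
    by move=> t /In_mapP[y _ ->].
  move=> y /In_mem/In_flatten[s /In_mapP[t /In_mapP[w Hw ->] ->]].
  by case=> [<-|//]; apply/xb/In_mem.
split=> // y; rewrite inE => /eqP ->.
have : x \in tgd_x d ++ tgd_z d.
  by apply: Hhead; apply/In_mem/In_flatten; exists a.2 => //; apply: In_map.
by rewrite mem_cat Hz orbF; apply: xb.
Qed.

Lemma atom_term_vars h (X : pred nat) :
  (forall u, List.In u h.2 -> {subset tvars u <= X}) ->
  {subset tvars (atom_term h) <= X}.
Proof.
move=> H y /In_mem/In_flatten[s /In_mapP[u Hu ->] /In_mem Hy].
exact: H Hu _ Hy.
Qed.

Lemma body_term_vars d : tvars (body_term d) = atoms_vars (tgd_body d).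
Proof.
rewrite /body_term /atoms_vars; elim: (tgd_body d) => [|a s IH] //=.
rewrite cats0 IH; congr (_ ++ _).
by rewrite -map_comp; elim: (a.2) => [|x t IHt] //=; rewrite IHt.
Qed.

Lemma body_term_over d : List.In d Gm -> term_over enc_sig (body_term d).
Proof.
move=> Hd; have [_ Hwf _ _] := Gm_wf Hd; rewrite /body_term.
have {}Hwf a : List.In a (tgd_body d) -> atom_wf a.
  by move=> Ha; apply: Hwf; apply/In_cat; left.
elim: (tgd_body d) Hwf => [|a s IH] Hwf.
  by apply: conj_over; apply: top_over.
apply: conj_over; last by apply: IH => b Hb; apply: Hwf; right.
apply: atom_term_over; first by rewrite /atom_wf size_map; apply: Hwf; left.
by move=> u /In_mapP[x _ ->].
Qed.

(** Transparent, so that [trs_rules enc_trs] reduces to [enc_rules]. *)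
Definition enc_trs : trs enc_sig.
Proof.
apply: (@Trs _ enc_sig enc_rules).
- move=> r /enc_rulesP[->|[b _ ->]|[d [h [Hd _ ->]]]]; try exact: top_over.
  exact: body_term_over.
- move=> r /enc_rulesP[->|[b Hb ->]|[d [h [Hd Hh ->]]]].
  + exact: (conj_over (top_over _) (top_over _)).
  + by have [? ?] := dom_atom_good nat Hb; exact: atom_term_over.
  + have [Hwf Hu] := skolem_head_good Hd Hh; apply: (atom_term_over Hwf) => u Hin.
    by case: (Hu _ Hin).
- move=> r /enc_rulesP[->|[b Hb ->]|[d [h [Hd Hh ->]]]].
  + by [].
  + by apply: atom_term_vars => u /In_mapP[e _ ->].
  + apply: atom_term_vars => u Hin; rewrite body_term_vars.
    by have [_ /(_ _ Hin)[]] := skolem_head_good Hd Hh.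
Defined.

Definition top_ground : ground_over enc_sig := exist _ top (top_over void).

Lemma enc_sig_for : signature_for Gm I enc_sig.
Proof.
split=> [r|d z Hd Hz|a e Ha He]; split=> //.
- exact: enc_sig_rel.
- exact/enc_sig_value/value_syms_sk.
- exact/enc_sig_value/(value_syms_dom Ha).
Qed.

(* The E-graph of an instance: one state per value, and the state [None] that
   represents [top], its conjunctions and all facts. *)
Section InstanceGraph.
Variable J : set (fact S D).

Definition good : Prop := forall a, J a -> atom_wf a /\
  forall u, List.In u a.2 -> term_over value_sig u.

(** Subterms are included so that the state of a value can be reached through the states of its
    arguments. *)
Definition active (v : value S D) : Prop :=
  exists a u, [/\ J a, List.In u a.2 & subterm v u].

Definition inst_state : Type := option {v | active v}.

Definition inst_trans (f : sym) (qs : seq inst_state) (q : inst_state) : Prop :=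
  match q with
  | Some v => exists2 vs, qs = map Some vs & sval v = App f (map sval vs)
  | None => [\/ f = AuxSym 0 /\ qs = [::],
                f = AuxSym 1 /\ qs = [:: None; None] |
                exists r vs, [/\ f = RelSym r, qs = map Some vs & J (r, map sval vs)]]
  end.

Hypothesis J_good : good.

Lemma active_over v : active v -> term_over value_sig v.
Proof.
move=> [a [u [/J_good[_ Hu] Hin Hv]]]; exact: term_over_subterm Hv (Hu _ Hin).
Qed.

Lemma inst_transP f qs q : inst_trans f qs q ->
  List.In f (sig_syms enc_sig) /\ size qs = sig_arity enc_sig f.
Proof.
case: q => [[v Hv] [vs -> /= E]|[[-> ->]|[-> ->]|[r [vs [-> -> /J_good[Hwf _]]]]]].
- have := active_over Hv; rewrite E => /term_over_args[Hf Hs _].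
  by split; [exact: enc_sig_value | move: Hs; rewrite !size_map].
- by split=> //; left.
- by split=> //; right; left.
- by split; [exact: enc_sig_rel | move: Hwf; rewrite /atom_wf !size_map].
Qed.

Definition inst_automaton : automaton enc_sig := Automaton inst_transP.

Lemma inst_eval_value s (v : {v | active v}) :
  eval (ground_in inst_automaton s) (Some v : state inst_automaton) -> s = sval v.
Proof.
elim/term_nested_ind: s v => [[]|f ts IH] v.
move=> /eval_ground_app[qs Hqs [vs E ->]].
move: Hqs; rewrite E => /Forall2_map_r H.
congr App; elim: H IH => [|t w ts' ws Htw _ IHts] IH //=; congr (_ :: _).
  by apply: IH => //; left.
by apply: IHts => u Hu; apply: IH; right.
Qed.


Lemma inst_eval_active v (Hv : active v) :
  eval (ground_in inst_automaton v) (Some (exist _ v Hv) : state inst_automaton).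
Proof.
elim/term_nested_ind: v Hv => [[]|f ts IH] Hv.
have act u : List.In u ts -> active u.
  move=> Hu; case: Hv => [a [w [Ha Hw Hs]]]; exists a, w; split=> //.
  exact: proper_subtermW (subterm_arg_proper Hu Hs).
have [ws E] : exists ws : seq {v | active v}, ts = map sval ws.
  elim: ts act {IH Hv} => [|u ts IH] act; first by exists [::].
  have [|ws ->] := IH; first by move=> w Hw; apply: act; right.
  by exists (exist _ u (act u (or_introl erefl)) :: ws).
apply/eval_ground_app; exists (map Some ws); last by exists ws => //=; rewrite -E.
subst ts; apply/Forall2_map_l/Forall2_map_r; apply: Forall2_refl_in => -[w Hw] Hin.
by apply: (IH w) => //; apply: (In_map sval Hin).
Qed.

(** A value state accepts only its own value, and no term is accepted both by a value state and by
    [None]. *)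
Lemma inst_det : deterministic inst_automaton.
Proof.
(* The root symbol decides the kind of state: Skolem functions and domain elements lead to value
   states, all others to [None]. *)
have head s q : eval (ground_in inst_automaton s) (q : state inst_automaton) ->
    if s is App f _ then is_value_sym f = isSome q else True.
  case: s => [//|f ts] /eval_ground_app[qs _].
  case: q => [v [vs _ E]|[[-> _]|[-> _]|[r [vs [-> _ _]]]]] //=.
  have := active_over (svalP v).
  by rewrite E => /term_over_args[/value_syms_is].
move=> s q1 q2 _ /reaches_eval H1 /reaches_eval H2.
have := head _ _ H1; have := head _ _ H2.
case: s H1 H2 => [[]|f ts] H1 H2 ->.
case: q1 q2 H1 H2 => [[v1 ?]|] [[v2 ?]|] // H1 H2 _.
have /= E1 := inst_eval_value H1; have /= E2 := inst_eval_value H2.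
by congr Some; apply: eq_exist; rewrite -E1 -E2.
Qed.

Lemma inst_eval_top : eval (ground_in inst_automaton top) (None : state inst_automaton).
Proof. by apply/eval_ground_app; exists [::]; [constructor | apply: Or31]. Qed.

Lemma inst_reach : reachable inst_automaton.
Proof.
move=> q; have [s Hs] : exists s, eval (ground_in inst_automaton s) q.
  case: q => [[v Hv]|]; first by exists v; apply: inst_eval_active.
  exists top; exact: inst_eval_top.
by exists s; [exact: eval_over Hs | exact/reaches_eval].
Qed.

Definition inst_egraph : egraph enc_sig := EGraph inst_det inst_reach.

End InstanceGraph.

(** * E-graphs that represent an instance *)

(** For a good [J] this says that [H] lies above the E-graph of [J], by [inst_le] in one direction
    and by [inst_models] with [models_hom] in the other. *)
Definition models (H : egraph enc_sig) (J : set (fact S D)) : Prop :=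
  exists q : state H, [/\ eval (ground_in H top) q,
    eval (ground_in H (conj top top)) q &
    forall a, J a -> eval (ground_in H (atom_term a)) q].

Lemma models_hom (G H : egraph enc_sig) J : hom_le G H -> models G J -> models H J.
Proof.
move=> [h hh] [q [Ht Hc Ha]]; exists (h q).
split=> [||a /Ha]; exact: eval_hom.
Qed.

Lemma models_sub H J J' : J `<=` J' -> models H J' -> models H J.
Proof. by move=> HJ [q [Ht Hc Ha]]; exists q; split=> // a /HJ/Ha. Qed.

Lemma inst_models J (HJ : good J) : models (inst_egraph HJ) J.
Proof.
have Ht := inst_eval_top HJ.
exists None; split=> [//||[r vs] Ha].
  apply/eval_ground_app; exists [:: None; None]; last exact: Or32.
  by do 3?constructor.
have [ws E] : exists ws : seq {v | active J v}, vs = map sval ws.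
  have act u : List.In u vs -> active J u.
    by move=> Hu; exists (r, vs), u; split=> //; apply: subterm_refl.
  elim: vs act {Ha} => [|u ts IH] act; first by exists [::].
  have [|ws ->] := IH; first by move=> w Hw; apply: act; right.
  by exists (exist _ u (act u (or_introl erefl)) :: ws).
subst vs; apply/eval_ground_app; exists (map Some ws).
  apply/Forall2_map_l/Forall2_map_r; apply: Forall2_refl_in => -[w Hw] _.
  exact: inst_eval_active.
by apply: Or33; exists r, ws.
Qed.

(** [None] goes to the common state [q], and a value to its own state in [H], which exists because
    the value is a subterm of an argument of a fact. *)
Lemma inst_le J (HJ : good J) (H : egraph enc_sig) :
  models H J -> hom_le (inst_egraph HJ) H.
Proof.
move=> [q [Ht Hc Ha]].
have val (v : {v | active J v}) : exists p, eval (ground_in H (sval v)) p.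
  case: v => [v [[r vs] [u [/Ha + Hu Hv]]]] /= => /eval_ground_app[qs Hqs _].
  by have [p _ Hp] := Forall2_in_l Hqs Hu; apply: eval_subterm Hv Hp.
pose k (p : state (inst_egraph HJ)) : state H :=
  if p is Some v then sval (cid (val v)) else q.
have kE v : eval (ground_in H (sval v)) (k (Some v)) := svalP (cid (val v)).
have step f vs p : eval (ground_in H (App f (map sval vs))) p ->
    trans f (map k (map Some vs)) p.
  move=> /eval_ground_app[ps /Forall2_map_l Hps].
  suff -> : ps = map k (map Some vs) by [].
  rewrite -map_comp; elim: Hps => [//|v p' vs' ps' Hp _ IH] /=.
  by rewrite IH (egraph_eval_uniq Hp (kE v)).
exists k => f qs [v [vs -> E]|[[-> ->]|[-> ->]|[r [vs [-> -> /Ha Hr]]]]].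
- by apply: step; rewrite -E.
- by move: Ht => /eval_ground_app[ps Hps]; inversion Hps.
- move: Hc => /eval_ground_app[ps Hps]; inversion Hps as [|? ? ? ? H1 H2]; subst.
  inversion H2 as [|? ? ? ? H3 H4]; subst; inversion H4; subst.
  by rewrite (egraph_eval_uniq H1 Ht) (egraph_eval_uniq H3 Ht).
- exact: step Hr.
Qed.

Lemma inst_language J (HJ : good J) a :
  language (inst_egraph HJ) (atom_term a) <-> J a.
Proof.
split=> [[_ [q /reaches_eval/eval_ground_app[qs Hqs]]]|Ha]; last first.
  have [q [_ _ /(_ _ Ha) Hq]] := inst_models HJ.
  by split; [exact: eval_over Hq | exists q; apply/reaches_eval].
case: q => [v [vs _ E]|[[]|[]|[r [vs [[Er] Eq Hr]]]]] //.
  have := active_over HJ (svalP v).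
  by rewrite E => /term_over_args[/value_syms_is].
suff E : a.2 = map sval vs by case: a Er E {Hqs} => r' us /= -> ->.
subst qs; move/Forall2_map_r: Hqs.
by elim=> [//|u v us' vs' /inst_eval_value -> _ ->].
Qed.


Lemma tsubst_dom_atom V W (s : V -> term sym W) (b : atom S D) :
  tsubst s (atom_term (dom_atom b)) = atom_term (dom_atom b).
Proof. by rewrite /= -!map_comp. Qed.

Lemma initial_good : good (initial_facts I).
Proof. by move=> _ [b Hb ->]; apply: dom_atom_good. Qed.

(** Head variables occur in the body, so their values are arguments of facts of [J]; Skolem terms
    over them stay in [value_sig]. *)
Lemma chase_step_good J : good J -> good (chase_step Gm J).
Proof.
move=> HJ a [/HJ //|[d [sg [Hd Hb [h Hh ->]]]]].
have [Hwf Hu] := skolem_head_good Hd Hh.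
split; first by rewrite /atom_wf size_map.
move=> _ /In_mapP[u /Hu[Ho Hv] ->].
have {}Hv x : x \in tvars u -> term_over value_sig (sg x).
  move=> /Hv/In_mem/In_flatten[_ /In_mapP[b Hbb ->] Hx].
  by have [_] := HJ _ (Hb _ Hbb); apply; apply: In_map.
elim/term_nested_ind: u Ho Hv {Hu} => [x _|f ts IH /term_over_args[Hf Hs Ht] Hv].
  by apply; rewrite inE.
apply/term_over_args; split=> //; first by rewrite size_map.
move=> _ /In_mapP[t Hin ->]; apply: IH => // [|x /In_mem Hx]; first exact: Ht.
by apply: Hv; apply/In_mem; exact: tvars_arg Hin Hx.
Qed.

(** The two halves bound [G] from above and below by the E-graph of [J], so [G] is isomorphic to
    it. *)
Definition represents (G : egraph enc_sig) J : Prop :=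
  exists HJ : good J, hom_le G (inst_egraph HJ) /\ models G J.

Lemma represents_xi (G : egraph enc_sig) J : represents G J -> xi G = J.
Proof.
move=> [HJ [HG HM]]; apply/seteqP; split=> a Ha.
  by apply/(inst_language HJ)/(language_hom HG).
exact/(language_hom (inst_le HJ HM))/inst_language.
Qed.

Lemma represents_iso (G H : egraph enc_sig) J : represents G J -> represents H J -> isomorphic G H.
Proof.
move=> [HJ [HG MG]] [HJ' [HH MH]]; apply: hom_le_antisym.
  exact: hom_le_trans HG (inst_le _ MH).
exact: hom_le_trans HH (inst_le _ MG).
Qed.

Lemma isomorphic_xi (G H : egraph enc_sig) : isomorphic G H -> xi G = xi H.
Proof.
move=> [h [k [hh hk _ _]]]; apply/seteqP; split=> a; apply: language_hom.
  by exists h.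
by exists k.
Qed.

(** * Matches of the rules, and one round against one chase step *)

Lemma body_term_conj d : exists s t, body_term d = conj s t.
Proof. by rewrite /body_term; case: (tgd_body d) => [|a s] /=; do 2 eexists. Qed.

Lemma eval_conj (A : automaton enc_sig) s t (c : state A) :
  eval (conj s t) c ->
  exists p q, [/\ eval s p, eval t q & trans (AuxSym 1) [:: p; q] c].
Proof.
move=> /eval_appP[qs Hqs Ht]; inversion Hqs as [|? p ? ? Hp H2]; subst.
by inversion H2 as [|? q ? ? Hq H4]; subst; inversion H4; subst; exists p, q.
Qed.

Lemma inst_trans_conj J (HJ : good J) qs (c : state (inst_egraph HJ)) :
  trans (AuxSym 1) qs c -> c = None /\ qs = [:: None; None].
Proof.
case: c => [v [vs _ E]|[[]|[_ ->]|[r [vs []]]]] //.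
have := active_over HJ (svalP v).
by rewrite E => /term_over_args[/value_syms_is].
Qed.

(** Soundness of matching: [conj] has only the transition from [None], [None] to [None], so each
    body atom evaluates to [None], which for a relation symbol means a fact of [J]. *)
Lemma eval_body_inst J (HJ : good J) (tau : nat -> state (inst_egraph HJ)) d c :
  eval (inst tau (body_term d)) c ->
  c = None /\ forall b, List.In b (tgd_body d) ->
    exists2 ws : seq {v | active J v},
      map tau b.2 = map Some ws & J (b.1, map sval ws).
Proof.
rewrite /body_term; elim: (tgd_body d) c => [|a s IH] c.
  by move=> /eval_conj[p [q [_ _ /inst_trans_conj[-> _]]]].
move=> /eval_conj[p [q [Hp Hq /inst_trans_conj[-> [Ep Eq]]]]]; subst p q.
have [_ {}IH] := IH _ Hq; split=> // b [<-{b}|]; last exact: IH.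
move: Hp => /eval_appP[qs Hqs [[]|[]|[r [ws [[->] E Hr]]]]] //.
exists ws => //; rewrite -E; move/Forall2_map_l/Forall2_map_l: Hqs.
by elim=> [//|x p' xs ps /eval_var_inv -> _ /= ->].
Qed.

(** The rules with left-hand side [top] are settled by the initial facts; only the dependency rules
    are left as a hypothesis. *)
Lemma ICO_le_inst (G : egraph enc_sig) J (HJ : good J)
    (h : state G -> state (inst_egraph HJ)) :
  is_hom h -> initial_facts I `<=` J ->
  (forall d hd sg c, List.In d Gm -> List.In hd (skolem_head D d) ->
    eval (inst sg (body_term d)) c -> eval (inst (h \o sg) (atom_term hd)) (h c)) ->
  hom_le (ICO enc_trs G) (inst_egraph HJ).
Proof.
move=> hh HI Hd; apply: (ICO_least (h := h)); split=> // r sg c [Hr /reaches_eval].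
have [q [Ht Hc Ha]] := inst_models HJ.
have hq : eval (inst sg top) c -> h c = q.
  move=> Htop; apply: egraph_eval_uniq Ht.
  exact: (eval_hom hh (s := top)).
move: Hr => /enc_rulesP[->|[b Hb ->]|[d [hd [Hdd Hhd ->]]]]; last exact: Hd.
- by move=> /hq ->.
- move=> /hq ->; have /Ha : J (dom_atom b) by apply: HI; exists b.
  by rewrite /inst /ground_in !tsubst_dom_atom.
Qed.

Lemma ICO_models_initial (G : egraph enc_sig) (q : state G) :
  eval (ground_in G top) q -> models (ICO enc_trs G) (initial_facts I).
Proof.
move=> Hq; have [h [hh hR]] := ICO_closed enc_trs G.
(* The pattern [top] has no variables, so a constant assignment serves. *)
have fire t : List.In (top, t) enc_rules -> eval (inst (h \o fun=> q) t) (h q).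
  by move=> Hr; apply: (hR (top, t)); split=> //; apply/reaches_eval.
exists (h q); split; first exact: eval_hom.
  by apply: (fire (conj top top)); apply/enc_rulesP; apply: Or31.
move=> _ [b Hb ->]; have : List.In (top, atom_term (dom_atom b)) enc_rules.
  by apply/enc_rulesP; apply: Or32; exists b.
by move/fire; rewrite /inst /ground_in !tsubst_dom_atom.
Qed.

Lemma chase_step_sub J : J `<=` chase_step Gm J.
Proof. by move=> a Ha; left. Qed.

(** Passing through the graph of [J] turns a match in [G] into body facts of [J], so the head is
    already a fact of the next stage. *)
Lemma ICO_le_step (G : egraph enc_sig) J (HJ : good J) (HJ' : good (chase_step Gm J)) :
  initial_facts I `<=` J -> hom_le G (inst_egraph HJ) ->
  hom_le (ICO enc_trs G) (inst_egraph HJ').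
Proof.
move=> HI [k hk].
have [j hj] := inst_le HJ (models_sub (@chase_step_sub J) (inst_models HJ')).
have [q' [Ht' _ Ha']] := inst_models HJ'.
have jN : j None = q'.
  by apply: egraph_eval_uniq Ht'; apply: (eval_hom hj); apply: inst_eval_top.
apply: (@ICO_le_inst _ _ _ (j \o k)).
- by move=> f qs q /hk/hj; rewrite -map_comp.
- by move=> a /HI; apply: chase_step_sub.
move=> d hd sg c Hd Hhd /(eval_mapv hk); rewrite mapv_inst => /eval_body_inst[/= -> Hb].
(* Body variables are always sent to value states, by [act]; [top] is a default for the other
   variables. *)
rewrite jN; pose s x : value S D := if k (sg x) is Some v then sval v else top.
have act b x : List.In b (tgd_body d) -> List.In x b.2 ->
    exists v, k (sg x) = Some v.
  move=> /Hb[ws E _] /(In_map (k \o sg)); rewrite E => /In_mapP[v _ Ev].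
  by exists v.
have body b : List.In b (tgd_body d) -> J (atom_map s b).
  move=> /Hb[ws E]; rewrite /atom_map; suff -> : map s b.2 = map sval ws by [].
  rewrite /s; elim: (b.2) ws E => [|x xs IH] [|w ws] //= [Ew /IH ->].
  by rewrite Ew.
have : chase_step Gm J (atom_map (tsubst s) hd).
  by right; exists d, s; split=> //; exists hd.
move/Ha' => Hq.
suff Hs x : List.In x (tvars (atom_term hd)) ->
    eval (ground_in (inst_egraph HJ') (s x)) (((j \o k) \o sg) x).
  exact: (iffLR (eval_inst _ Hs)).
move=> /In_mem Hx; have : x \in atoms_vars (tgd_body d).
  apply: (atom_term_vars _ Hx) => u Hu.
  by have [_ /(_ _ Hu)[]] := skolem_head_good Hd Hhd.
move=> /In_mem/In_flatten[_ /In_mapP[b Hbb ->] Hxb].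
have [v Ev] := act _ _ Hbb Hxb.
rewrite /s /= Ev; apply: (eval_hom hj); case: (v) => w Hw.
exact: inst_eval_active.
Qed.

(** Since [top] and [conj top top] share the state [q], there is a transition of [conj] from [q],
    [q] to [q], which absorbs the atoms one by one. *)
Lemma models_body (G : egraph enc_sig) (q : state G) d (s : nat -> value S D) :
  eval (ground_in G top) q -> eval (ground_in G (conj top top)) q ->
  (forall b, List.In b (tgd_body d) ->
    eval (ground_in G (atom_term (atom_map s b))) q) ->
  eval (ground_in G (tsubst s (body_term d))) q.
Proof.
move=> Ht Hc; rewrite /body_term; elim: (tgd_body d) => [|a bs IH] Hb //.
have [p1 [p2 [H1 H2 Htr]]] := eval_conj Hc.
have E1 := egraph_open_uniq H1 Ht; have E2 := egraph_open_uniq H2 Ht; subst p1 p2.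
have Ha : eval (ground_in G (tsubst s (atom_term (atom_map Var a)))) q.
  have -> : tsubst s (atom_term (atom_map Var a)) = atom_term (atom_map s a).
    by rewrite /atom_term /= -map_comp.
  by apply: Hb; left.
apply/eval_ground_app; exists [:: q; q] => //.
apply: List.Forall2_cons Ha (List.Forall2_cons _ _ _ (List.Forall2_nil _)).
by apply: IH => b Hbb; apply: Hb; right.
Qed.

Lemma ICO_models_step (G : egraph enc_sig) J :
  models G J -> models (ICO enc_trs G) (chase_step Gm J).
Proof.
move=> [q [Ht Hc Ha]]; have [h [hh hR]] := ICO_closed enc_trs G.
exists (h q); split; [exact: (eval_hom hh) | exact: (eval_hom hh) | move=> a].
case=> [/Ha/(eval_hom hh) //|[d [s [Hd Hb [hd Hhd ->]]]]].
(* A body variable has a value with a state, as an argument of a fact that evaluates; [q] is the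
   default elsewhere. *)
have ex x : exists p, forall b, List.In b (tgd_body d) -> List.In x b.2 ->
    eval (ground_in G (s x)) p.
  have [[p Hp]|Hno] := pselect (exists p, eval (ground_in G (s x)) p).
    by exists p.
  exists q => b /Hb/Ha/eval_ground_app[qs Hqs _] /(In_map s) Hx; case: Hno.
  by have [p _ Hp] := Forall2_in_l Hqs Hx; exists p.
pose sg x := sval (cid (ex x)).
have sgP x : x \in atoms_vars (tgd_body d) -> eval (ground_in G (s x)) (sg x).
  move=> /In_mem/In_flatten[_ /In_mapP[b Hbb ->] Hxb].
  exact: (svalP (cid (ex x))) Hbb Hxb.
have Hm : matches enc_trs (body_term d, atom_term hd) sg q.
  split; first by apply/enc_rulesP; apply: Or33; exists d, hd.
  apply/reaches_eval/(eval_inst (s := s)).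
    by move=> x /In_mem; rewrite body_term_vars; apply: sgP.
  by apply: models_body => // b /Hb/Ha.
suff Hs x : List.In x (tvars (atom_term hd)) ->
    eval (ground_in (ICO enc_trs G) (s x)) ((h \o sg) x).
  exact: (iffRL (eval_inst _ Hs)) (hR _ _ _ Hm).
move=> /In_mem Hx.
apply: (eval_hom hh); apply: sgP; apply: (atom_term_vars _ Hx) => u Hu.
by have [_ /(_ _ Hu)[]] := skolem_head_good Hd Hhd.
Qed.

(** The seeding rules fire again in every round; containment of the initial facts in [J] makes this
    harmless. *)
Lemma represents_step (G : egraph enc_sig) J : initial_facts I `<=` J ->
  represents G J -> represents (ICO enc_trs G) (chase_step Gm J).
Proof.
move=> HI [HJ [HG HM]]; exists (chase_step_good HJ).
by split; [exact: ICO_le_step HG | exact: ICO_models_step].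
Qed.

Lemma subterm_top (u : gterm sym) : subterm u top -> u = top.
Proof. by move=> H; inversion H. Qed.

(** The first round only seeds: every body pattern has root [conj], and the graph of [top] has no
    transition for that symbol. *)
Lemma represents_initial :
  represents (ICO enc_trs (term_egraph top_ground)) (initial_facts I).
Proof.
exists initial_good; split.
  apply: (@ICO_le_inst _ _ _ (fun=> None)) => //.
    move=> f qs q /=; rewrite /tg_trans (subterm_top (svalP q)) => -[<- E].
    by case: qs E => // _; apply: Or31.
  move=> d hd sg c _ _; have [t1 [t2 ->]] := body_term_conj d.
  move=> /eval_conj[p1 [p2 [_ _]]] /=; rewrite /tg_trans.
  by rewrite (subterm_top (svalP c)).
pose q : state (term_egraph top_ground) := exist _ top (subterm_refl _).
by apply: (ICO_models_initial (q := q)); apply/tg_eval.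
Qed.

(** * Stages, limits and termination *)

Let chase n := iter n (chase_step Gm) (initial_facts I).
Let saturation n := iter n (ICO enc_trs) (term_egraph top_ground).

Lemma chase_mono m n : m <= n -> chase m `<=` chase n.
Proof.
move=> /subnK <-; elim: (n - m)%N => [//|k IH] a /IH; exact: chase_step_sub.
Qed.

Lemma represents_saturation n : represents (saturation n.+1) (chase n).
Proof.
elim: n => [|n IH]; first exact: represents_initial.
by apply: represents_step IH; apply: (@chase_mono 0 n).
Qed.

Lemma chase_step_mono J J' : J `<=` J' -> chase_step Gm J `<=` chase_step Gm J'.
Proof.
move=> HJ a [/HJ|[d [s [Hd Hb Hh]]]]; first by left.
by right; exists d, s; split=> // b /Hb/HJ.
Qed.

(** A body is finite, so its facts all lie in one stage; hence the union of the stages is already a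
    fixpoint. *)
Lemma SklChE : SklCh Gm I = [set a | exists n, chase n a].
Proof.
apply/seteqP; split=> a; last first.
  move=> [n Hn] J [HJ HI]; elim: n a Hn => [a /HI //|n IH a Hn].
  by rewrite -HJ; apply: chase_step_mono Hn.
apply; split; last by move=> b Hb; exists 0.
apply/seteqP; split; last exact: chase_step_sub.
move=> b [//|[d [s [Hd Hb Hh]]]].
have [n Hn] : exists n, forall b, List.In b (tgd_body d) -> chase n (atom_map s b).
  elim: (tgd_body d) Hb {Hd Hh} => [|c bs IH] Hb; first by exists 0.
  have [|n Hn] := IH; first by move=> e He; apply: Hb; right.
  have [m Hm] := Hb c (or_introl erefl).
  exists (maxn m n) => e [<-|He].
    exact: chase_mono (leq_maxl _ _) _ Hm.
  exact: chase_mono (leq_maxr _ _) _ (Hn _ He).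
by exists n.+1; right; exists d, s.
Qed.

(** The graph of the full chase is an upper bound of the rounds, and the supremum models every
    stage. *)
Lemma represents_EqSat : represents (EqSat enc_trs top_ground) (SklCh Gm I).
Proof.
have [above least] := egraph_sup_least saturation.
have HU : good (SklCh Gm I).
  rewrite SklChE => a [n Hn].
  by have [HJ _] := represents_saturation n; apply: HJ.
exists HU; split.
  apply: least => n.
  have H m : hom_le (saturation m.+1) (inst_egraph HU).
    have [HJ [HG _]] := represents_saturation m.
    apply: hom_le_trans HG (inst_le _ _); apply: models_sub (inst_models HU).
    by move=> a Ha; rewrite SklChE; exists m.
  case: n => [|n]; last exact: H.
  (* Round 0 represents no stage, but it lies below round 1. *)
  by apply: hom_le_trans (H 0); have [h [hh _]] := ICO_closed enc_trs (saturation 0); exists h.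
have M n : models (egraph_sup saturation) (chase n).
  by have [_ [_ HM]] := represents_saturation n; apply: models_hom HM.
have [q [Ht Hc _]] := M 0; exists q; split=> // a; rewrite SklChE => -[n Hn].
(* The common state could vary with the stage; being the state of [top], it does not. *)
by have [q' [Ht' _ /(_ _ Hn)]] := M n; rewrite (egraph_eval_uniq Ht' Ht).
Qed.

(** Rounds that represent the same stage are isomorphic, and isomorphic rounds have the same facts
    under [xi], so stabilization transfers both ways with a shift by one. *)
Lemma enc_terminates :
  SklCh_terminates Gm I <-> EqSat_terminates enc_trs top_ground.
Proof.
split=> [[n En]|[[|n] Hiso]].
- exists n.+1; apply: (@represents_iso _ _ (chase n)); last exact: represents_saturation.
  suff <- : chase n.+1 = chase n by apply: (represents_saturation n.+1).
  apply/seteqP; split=> a; last exact: chase_step_sub.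
  by rewrite {2}/chase En SklChE => Ha; exists n.+1.
(* Round 0 cannot be a fixpoint: round 1 evaluates [conj top top], which the graph of [top] does
   not. *)
- have [h [_ [hh _ _ _]]] := Hiso.
  have [_ [_ [q [_ Hc _]]]] := represents_saturation 0.
  have /tg_eval E := eval_hom hh Hc.
  by have := subterm_top (svalP (h q)); rewrite -E.
- exists n; apply/seteqP; split=> a.
    by rewrite SklChE => Ha; exists n.
  apply; split; last exact: (@chase_mono 0 n).
  exact: etrans (esym (represents_xi (represents_saturation n.+1)))
    (etrans (isomorphic_xi Hiso) (represents_xi (represents_saturation n))).
Qed.

End Encoding.

Theorem theorem28 (S : schema) (D : Type) (Gamma : seq (tgd S))
    (I : seq (atom S D)) :
  (forall d, List.In d Gamma -> tgd_wf d) ->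
  (forall a, List.In a I -> atom_wf a) ->
  exists (Sigma : signature (symbol S D)) (R : trs Sigma)
      (t : ground_over Sigma),
    [/\ signature_for Gamma I Sigma,
        xi (EqSat R t) = SklCh Gamma I &
        SklCh_terminates Gamma I <-> EqSat_terminates R t].
Proof.
move=> Gamma_wf I_wf.
exists (enc_sig Gamma I), (enc_trs Gamma_wf I_wf), (top_ground Gamma I).
split; [exact: enc_sig_for | | exact: enc_terminates].
exact/represents_xi/represents_EqSat.
Qed.
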